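(* Let $(X,\mu)$ be a standard atomless probability space and let $T\in\mathrm{Aut}(X,[\mu])$ be ergodic. The following normal subgroups of the commensurating full group $[T]_{\mathrm{com}}$ are all equal: (1) the subgroup generated by the periodic elements of $[T]_{\mathrm{com}}$; (2) the subgroup generated by the involutions of $[T]_{\mathrm{com}}$; (3) the closure $\overline{D([T]_{\mathrm{com}})}$ in $[T]_{\mathrm{com}}$ of the derived subgroup of $[T]_{\mathrm{com}}$; (4) the kernel of the index map $I:[T]_{\mathrm{com}}\to\mathbb Z$.
   Context: $\mathrm{Aut}(X,[\mu])$ is the group of measurable bijections $T:X\to X$ such that $T_*\mu$ and $\mu$ have the same null sets, two such maps being identified if they agree almost everywhere. $T$ is ergodic if every $T$-invariant Borel set is null or conull; $T$ is aperiodic if almost every $T$-orbit is infinite (ergodic transformations are aperiodic since $\mu$ is atomless). A transformation is periodic if almost all its orbits are finite; an involution is a transformation $U$ with $U^2=\mathrm{id}$. Let $T\in\mathrm{Aut}(X,[\mu])$ be aperiodic. The full group $[T]$ is the group of $S\in\mathrm{Aut}(X,[\mu])$ such that for a.e. $x$, $S(x)=T^{c_S(x)}(x)$ for some integer $c_S(x)$; the a.e. uniquely defined measurable map $c_S:X\to\mathbb Z$ is the cocycle of $S$. Let $\mathrm{Sym}(\mathbb Z,\mathbb N)$ be the group of permutations $\sigma$ of $\mathbb Z$ with $|\sigma(\mathbb N)\triangle\mathbb N|<\infty$, with the group topology for which a basis of neighborhoods of the identity is given by the pointwise stabilizers of finite subsets of $\mathrm{Comm}(\mathbb N)=\{M\subset\mathbb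 Z: |M\triangle\mathbb N|<\infty\}$. For $S\in[T]$, $x\in X$, define the permutation $\Phi(S)(x)$ of $\mathbb Z$ by $\Phi(S)(x)(n)=n+c_S(T^n(x))$. The commensurating full group is $$[T]_{\mathrm{com}}=\{S\in[T]:\ \Phi(S)(x)\in\mathrm{Sym}(\mathbb Z,\mathbb N)\text{ for a.e. }x\},$$ endowed with the topology pulled back by $\Phi$ from $\mathrm L^0(X,\mu,\mathrm{Sym}(\mathbb Z,\mathbb N))$, the group (under pointwise multiplication) of measurable maps $X\to\mathrm{Sym}(\mathbb Z,\mathbb N)$ modulo a.e. equality, with the topology of convergence in measure. Index map: for $\sigma\in\mathrm{Sym}(\mathbb Z,\mathbb N)$ put $I(\sigma)=|\mathbb N\setminus\sigma(\mathbb N)|-|\sigma(\mathbb N)\setminus\mathbb N|$. If $T$ is ergodic and $S\in[T]_{\mathrm{com}}$, the integer $I(\Phi(S)(x))$ is the same for a.e. $x$; this common value is denoted $I(S)$, and $I:[T]_{\mathrm{com}}\to\mathbb Z$ is a continuous homomorphism. *)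

(* Defs.v *)
From HB Require Import structures.
From mathcomp Require Import all_boot all_order all_algebra finmap.
From mathcomp Require Import all_classical all_reals all_analysis.

Set Implicit Arguments.
Unset Strict Implicit.
Unset Printing Implicit Defensive.

Import Order.TTheory GRing.Theory Num.Theory.
Import numFieldNormedType.Exports.

Local Open Scope classical_set_scope.
Local Open Scope ring_scope.
Local Open Scope quotient_scope.

(* The measurable structure of X is transported from the Borel sigma-algebra of
   a separable complete metric space P.  A [completePseudoMetricType] is a
   uniform space presented by balls; with [hausdorff_space] it is metrizable by
   a complete metric. *)
Definition standard_borel (R : realType) d (X : measurableType d) : Prop :=
  exists (P : completePseudoMetricType R) (f : X -> P),
    [/\ hausdorff_space P, @second_countable P, bijective f &
        forall A : set X, measurable A <-> <<s open >> (f @` A)].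

Definition atom (R : realType) d (X : measurableType d)
    (mu : probability X R) (A : set X) : Prop :=
  [/\ measurable A, (0 < mu A)%E &
      forall B, measurable B -> B `<=` A -> mu B = 0%E \/ mu B = mu A].

Definition atomless (R : realType) d (X : measurableType d)
    (mu : probability X R) : Prop := forall A, ~ atom mu A.

Section nonsingular_bijections.
Context (R : realType) d (X : measurableType d) (mu : probability X R).

Record nsbij := NSBij {
  nsfun :> X -> X;
  nsinv : X -> X;
  nsfunK : cancel nsfun nsinv;
  nsinvK : cancel nsinv nsfun;
  measurable_nsfun : measurable_fun setT nsfun;
  measurable_nsinv : measurable_fun setT nsinv;
  nsfun_null : forall A, measurable A ->
    pushforward mu nsfun A = 0%E <-> mu A = 0%E }.

HB.instance Definition _ := gen_eqMixin nsbij.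
HB.instance Definition _ := gen_choiceMixin nsbij.

Lemma nsinv_null (S : nsbij) A : measurable A ->
  pushforward mu (nsinv S) A = 0%E <-> mu A = 0%E.
Proof.
move=> mA; rewrite /pushforward.
have mSA : measurable (nsinv S @^-1` A).
  by rewrite -[X in measurable X]setTI; exact: measurable_nsinv.
rewrite -(nsfun_null S mSA) /pushforward -comp_preimage.
suff -> : (nsinv S \o S) @^-1` A = A by [].
by apply/seteqP; split => x /=; rewrite nsfunK.
Qed.

Definition nsbij1 : nsbij.
Proof.
by apply: (@NSBij id id) => //; exact: measurable_id.
Defined.

Definition nsbijV (S : nsbij) : nsbij :=
  NSBij (nsinvK S) (nsfunK S) (measurable_nsinv S) (measurable_nsfun S)
    (nsinv_null S).

Lemma nsbijM_null (S T : nsbij) A : measurable A ->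
  pushforward mu (S \o T) A = 0%E <-> mu A = 0%E.
Proof.
move=> mA.
have mSA : measurable (S @^-1` A).
  by rewrite -[X in measurable X]setTI; exact: measurable_nsfun.
by rewrite -(nsfun_null S mA) -(nsfun_null T mSA) /pushforward comp_preimage.
Qed.

Definition nsbijM (S T : nsbij) : nsbij :=
  @NSBij (S \o T) (nsinv T \o nsinv S)
    (can_comp (nsfunK S) (nsfunK T)) (can_comp (nsinvK T) (nsinvK S))
    (measurableT_comp (measurable_nsfun S) (measurable_nsfun T))
    (measurableT_comp (measurable_nsinv T) (measurable_nsinv S))
    (@nsbijM_null S T).

Lemma ae_nsbij (S : nsbij) (P : set X) :
  (\forall x \ae mu, P x) -> \forall x \ae mu, P (S x).
Proof.
move=> [N [mN N0 PN]]; exists (S @^-1` N); split.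
- by rewrite -[X in measurable X]setTI; exact: measurable_nsfun.
- exact/(nsfun_null S mN).
- by move=> x /= nPx; exact: PN.
Qed.

Definition nsbij_eq (S T : nsbij) := `[< \forall x \ae mu, S x = T x >].

Lemma nsbij_eq_refl : reflexive nsbij_eq.
Proof. by move=> S; apply/asboolP; apply: filterE. Qed.

Lemma nsbij_eq_sym : symmetric nsbij_eq.
Proof.
by move=> S T; apply/asboolP/asboolP; apply: filterS => x ->.
Qed.

Lemma nsbij_eq_trans : transitive nsbij_eq.
Proof.
move=> T S U /asboolP ST /asboolP TU; apply/asboolP.
by apply: filterS2 ST TU => x -> ->.
Qed.

Canonical nsbij_eq_canonical :=
  EquivRel nsbij_eq nsbij_eq_refl nsbij_eq_sym nsbij_eq_trans.

(* The group Aut(X,[mu]), with (S * T)%g the composition S o T. *)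
Definition Aut : Type := {eq_quot nsbij_eq}.
HB.instance Definition _ := Choice.on Aut.
HB.instance Definition _ := EqQuotient.on Aut.

Definition Aut_repr (S : Aut) : nsbij := repr S.
Coercion Aut_repr : Aut >-> nsbij.

Lemma Aut_eqP (S T : nsbij) :
  \pi_Aut S = \pi_Aut T <-> \forall x \ae mu, S x = T x.
Proof. by split => [/eqmodP/asboolP|ST]; last exact/eqmodP/asboolP. Qed.

Lemma Aut_piE (S : nsbij) : \forall x \ae mu, (\pi_Aut S : Aut) x = S x.
Proof. by apply/Aut_eqP; rewrite reprK. Qed.

Definition Aut1 : Aut := \pi_Aut nsbij1.
Definition AutM (S T : Aut) : Aut := \pi_Aut (nsbijM S T).
Definition AutV (S : Aut) : Aut := \pi_Aut (nsbijV S).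

Lemma AutMA : associative AutM.
Proof.
move=> S T U; apply/Aut_eqP.
have h1 := Aut_piE (nsbijM T U).
have h2 := ae_nsbij U (Aut_piE (nsbijM S T)).
by apply: filterS2 h1 h2 => x /= -> ->.
Qed.

Lemma Aut1M : left_id Aut1 AutM.
Proof.
move=> S; rewrite -[RHS]reprK; apply/Aut_eqP.
by have := ae_nsbij S (Aut_piE nsbij1); apply: filterS => x /= ->.
Qed.

Lemma AutM1 : right_id Aut1 AutM.
Proof.
move=> S; rewrite -[RHS]reprK; apply/Aut_eqP.
by have := Aut_piE nsbij1; apply: filterS => x /= ->.
Qed.

Lemma AutVM : left_inverse Aut1 AutV AutM.
Proof.
move=> S; apply/Aut_eqP.
have := ae_nsbij S (Aut_piE (nsbijV S)); apply: filterS => x /= ->.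
by rewrite nsfunK.
Qed.

Lemma AutMV : right_inverse Aut1 AutV AutM.
Proof.
move=> S; apply/Aut_eqP.
by have := Aut_piE (nsbijV S); apply: filterS => x /= ->; rewrite nsinvK.
Qed.

HB.instance Definition _ := isGroup.Build Aut AutMA Aut1M AutM1 AutVM AutMV.

End nonsingular_bijections.

Section dynamics.
Context (R : realType) d (X : measurableType d) (mu : probability X R).

Definition iterz (T : nsbij mu) (n : int) (x : X) : X :=
  match n with
  | Posz k => iter k T x
  | Negz k => iter k.+1 (nsinv T) x
  end.

Definition orbitz (T : nsbij mu) (x : X) : set X := range (iterz T ^~ x).

(* This and the notions below do not depend on the representative chosen for an
   element of [Aut mu]. *)
Definition ergodic (T : Aut mu) : Prop :=
  forall A, measurable A -> T @^-1` A = A -> mu A = 0%E \/ mu (~` A) = 0%E.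

Definition ae_periodic (T : Aut mu) : Prop :=
  \forall x \ae mu, finite_set (orbitz T x).

Definition involution (U : Aut mu) : Prop := (U * U = 1)%g.

Definition full_group (T : Aut mu) : set (Aut mu) :=
  [set S | \forall x \ae mu, exists n, S x = iterz T n x].

End dynamics.

HB.instance Definition _ := isPointed.Build int 0.
HB.instance Definition _ := @isMeasurable.Build default_measure_display
  int discrete_measurable discrete_measurable0
  discrete_measurableC discrete_measurableU.

(* The subset N of Z. *)
Definition Nset : set int := [set n | 0 <= n].

Definition CommN : set (set int) := [set M | finite_set (M `+` Nset)].

Definition is_symZN (s : int -> int) : Prop :=
  bijective s /\ finite_set ((s @` Nset) `+` Nset).

Record symZN := SymZN { symZN_fun :> int -> int; symZNP : is_symZN symZN_fun }.

HB.instance Definition _ := gen_eqMixin symZN.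
HB.instance Definition _ := gen_choiceMixin symZN.

Lemma is_symZN_id : is_symZN id.
Proof. by split; [exists id | rewrite image_id setYK]. Qed.

HB.instance Definition _ := isPointed.Build symZN (SymZN is_symZN_id).

(* Both sets are finite by [symZNP]. *)
Definition symZN_index (s : symZN) : int :=
  #|` fset_set (Nset `\` s @` Nset)|%:Z - #|` fset_set (s @` Nset `\` Nset)|%:Z.

Section symZN_uniform.
Local Open Scope relation_scope.

(* The pairs (s, t) such that s^-1 t stabilizes every element of F; these
   generate the left uniformity of the group topology. *)
Definition symZN_stab (F : set (set int)) : set (symZN * symZN) :=
  [set st : symZN * symZN | forall M, F M -> st.1 @` M = st.2 @` M].

Definition symZN_ent : set_system (symZN * symZN) :=
  filter_from [set F | finite_set F /\ F `<=` CommN] symZN_stab.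

Lemma symZN_ent_filter : Filter symZN_ent.
Proof.
apply: filter_from_filter; first by exists set0; split => //; exact: finite_set0.
move=> F G [fF sF] [fG sG]; exists (F `|` G).
  by split; [rewrite finite_setU | move=> M [/sF|/sG]].
by move=> st h; split => M FM; apply: h; [left|right].
Qed.

Lemma symZN_ent_diagonal A : symZN_ent A -> diagonal `<=` A.
Proof. by move=> [F _ FA] [s t] /= st; apply: FA => M _ /=; rewrite [s]st. Qed.

Lemma symZN_ent_inv A : symZN_ent A -> symZN_ent A^-1.
Proof. by move=> [F hF FA]; exists F => // -[s t] h; apply: FA => M /h. Qed.

Lemma symZN_ent_split A :
  symZN_ent A -> exists2 B, symZN_ent B & B \; B `<=` A.
Proof.
move=> [F hF FA]; exists (symZN_stab F); first by exists F.
by move=> [s t] [u /= su ut]; apply: FA => M FM /=; rewrite (su M FM) (ut M FM).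
Qed.

HB.instance Definition _ := isUniform.Build symZN
  symZN_ent_filter symZN_ent_diagonal symZN_ent_inv symZN_ent_split.

End symZN_uniform.

(* Borel maps X -> G modulo almost everywhere equality.  The uniform structure
   put on them below is that of convergence in measure. *)
Definition L0 (R : realType) d (X : measurableType d) (mu : probability X R)
    (G : puniformType) : Type :=
  {mfun_ mu, X >-> g_sigma_algebraType (@open G)}.

Definition L0_fun (R : realType) d (X : measurableType d)
    (mu : probability X R) (G : puniformType) (f : L0 mu G) : X -> G :=
  aqEqMfun_to_fun f.
Coercion L0_fun : L0 >-> Funclass.

Section convergence_in_measure.
Local Open Scope relation_scope.
Context (R : realType) d (X : measurableType d) (mu : probability X R)
  (G : puniformType).

Local Notation L0 := (L0 mu G).

HB.instance Definition _ := Choice.on L0.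

(* [mu_ext mu] is the outer measure of mu; it agrees with mu on measurable sets
   and gives a meaning to the condition when V is not measurable. *)
Definition L0_close (V : set (G * G)) (e : R) : set (L0 * L0) :=
  [set fg : L0 * L0 | (mu_ext mu [set x | ~ V (fg.1 x, fg.2 x)] < e%:E)%E].

Definition L0_ent : set_system (L0 * L0) :=
  filter_from [set Ve : set (G * G) * R | entourage Ve.1 /\ 0 < Ve.2]
    (fun Ve => L0_close Ve.1 Ve.2).

Lemma L0_ent_filter : Filter L0_ent.
Proof.
apply: filter_from_filter.
  by exists (setT, 1); split => //=; exact: filterT.
move=> [V e] [W r] /= [eV e0] [eW r0]; exists (V `&` W, Num.min e r).
  by split => /=; [exact: filterI | rewrite lt_min e0].
move=> [f g]; rewrite /L0_close /= => h; split => /=.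
- apply: le_lt_trans (lt_le_trans h _); last by rewrite lee_fin ge_min lexx.
  by apply: le_outer_measure => x /= nV [].
- apply: le_lt_trans (lt_le_trans h _); last by rewrite lee_fin ge_min lexx orbT.
  by apply: le_outer_measure => x /= nV [].
Qed.

Lemma L0_ent_diagonal A : L0_ent A -> diagonal `<=` A.
Proof.
move=> [[V e] /= [eV e0] VA] [f g] /= fg; apply: VA; rewrite /L0_close /= [f]fg.
suff -> : [set x | ~ V (g x, g x)] = set0 by rewrite outer_measure0 lte_fin.
by apply/seteqP; split => x //=; apply; exact: entourage_refl.
Qed.

Lemma L0_ent_inv A : L0_ent A -> L0_ent A^-1.
Proof.
move=> [[V e] /= [eV e0] VA]; exists (V^-1, e).
  by split => //=; exact: entourage_inv.
by move=> [f g] h; apply: VA.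
Qed.

Lemma L0_ent_split A : L0_ent A -> exists2 B, L0_ent B & B \; B `<=` A.
Proof.
move=> [[V e] /= [eV e0] VA].
have [W eW WV] := entourage_split_ex eV.
exists (L0_close W (e / 2)).
  by exists (W, e / 2) => //; split => //=; rewrite divr_gt0.
move=> [f g] [h /= fh hg]; apply: VA; rewrite /L0_close /=.
have /le_lt_trans : (mu_ext mu [set x | ~ V (f x, g x)] <=
    mu_ext mu [set x | ~ W (f x, h x)] + mu_ext mu [set x | ~ W (h x, g x)])%E.
  apply: le_trans (outer_measureU2 _ _ _); apply: le_outer_measure => x /= nV.
  apply/not_andP => -[Wfh Whg]; apply: nV; apply: WV.
  by exists (h x).
by apply; rewrite [e]splitr EFinD; exact: lteD.
Qed.

HB.instance Definition _ := isUniform.Build L0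
  L0_ent_filter L0_ent_diagonal L0_ent_inv L0_ent_split.

End convergence_in_measure.

Section commensurating_full_group.
Context (R : realType) d (X : measurableType d) (mu : probability X R).

(* The three definitions by [xget] below select the unique object (up to null
   sets) with the given property, the first argument of [xget] being the value
   taken when there is none.  For T aperiodic the cocycle exists for S in the
   full group of T and Phi for S in [T]_com; for T ergodic the index exists on
   [T]_com. *)
Definition cocycle (T S : Aut mu) : {mfun_ mu, X >-> int} :=
  xget (\pi_({mfun_ mu, X >-> int}) (cst 0 : {mfun X >-> int}))
    [set c : {mfun_ mu, X >-> int} | \forall x \ae mu, S x = iterz T (c x) x].

Definition Phi_fun (T S : Aut mu) (x : X) (n : int) : int :=
  n + cocycle T S (iterz T n x).

Definition com_full_group (T : Aut mu) : set (Aut mu) :=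
  [set S | full_group T S /\ \forall x \ae mu, is_symZN (Phi_fun T S x)].

Definition Phi (T S : Aut mu) : L0 mu symZN :=
  xget (\pi_({mfun_ mu, X >-> g_sigma_algebraType (@open symZN)})
      (cst point : {mfun X >-> g_sigma_algebraType (@open symZN)}))
    [set f : L0 mu symZN |
      \forall x \ae mu, (f x : symZN) = Phi_fun T S x :> (int -> int)].

Definition com_index (T S : Aut mu) : int :=
  xget 0 [set k | \forall x \ae mu, symZN_index (Phi T S x) = k].

(* The type of elements of [T]_com, with the topology pulled back by Phi. *)
Definition com_space (T : Aut mu) : topologicalType :=
  initial_topology (fun S : com_full_group T => Phi T (val S)).

(* The closure in [T]_com of a subset A of [T]_com. *)
Definition com_closure (T : Aut mu) (A : set (Aut mu)) : set (Aut mu) :=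
  [set val S | S in closure
    ([set S : com_full_group T | A (val S)] : set (com_space T))].

End commensurating_full_group.

Section subgroups.
Context (G : groupType).
Implicit Types A H K : set G.

Definition subgroup_generated A : set G :=
  smallest (fun H => group_closed (mem H)) A.

Definition derived_subgroup H : set G :=
  subgroup_generated [set [~ a, b]%g | a in H & b in H].

Definition normal_subgroup K H : Prop :=
  [/\ K `<=` H, group_closed (mem K) &
      forall h k, H h -> K k -> K (k ^ h)%g].

End subgroups.

(* Main.v *)
Require Import Defs.
From mathcomp Require Import all_boot all_order all_algebra finmap.
From mathcomp Require Import all_classical all_reals all_analysis.
From mathcomp Require Import zify.

Set Implicit Arguments.
Unset Strict Implicit.
Unset Printing Implicit Defensive.

Import Order.TTheory GRing.Theory Num.Theory.

Local Open Scope classical_set_scope.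
Local Open Scope ring_scope.

(** Write t for T, and Phi S x for the permutation of Z that S induces on the
    orbit of x, identified with Z by n |-> t^n x. By ergodicity and the absence
    of atoms, almost every orbit is infinite and returns infinitely often, in
    both directions, to any given set of positive measure ([ae_aperiodic],
    [ae_recurrent]). Hence S |-> Phi S x is multiplicative, and elements of the
    full group are handled through permutations of Z that depend measurably on x
    and equivariantly on its position in the orbit. The only elements that have to
    be constructed are involutions, and for these it is enough to give a measurable
    family of jumps that is undone by itself ([involution_of_jump]).

    The four subgroups are compared along the chain
      periodic = involutions <= closure of D <= kernel of I <= involutions.

    - A periodic element S has finite cycles on almost every orbit. Reflecting
      every cycle around its least element is an involution U such that S U is an
      involution too. Both stay in the commensurating full group: only finitely
      many cycles of Phi S x meet both N and its complement, and the reflections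
      preserve every cycle ([finite_cycles_involutions]).
    - Let U be an involution. The points that U moves to the right are matched
      among themselves by a measurable involution whose jumps lie in the full
      group ([matching]). Keep the matched pairs at distance at most k; this gives
      a bounded involution, and the part of U over these pairs is the
      commutator of that involution, extended symmetrically by U, with the part
      of U over one point of each pair ([commutator_of_matching]). For almost every x
      and every M commensurate to N, only finitely many integers cross M under
      Phi U x, and all of them are taken care of for k large, so that these
      commutators tend to U ([involution_limit]). Limits almost everywhere of
      elements of D form a group ([ae_limits_closed]) contained in its closure
      ([ae_tends_closure]).
    - The index is the sum over n of the differences between the indicator of N at
      Phi S x n and at n, hence is additive ([zindex_comp]); it is invariant under
      translations, hence almost everywhere constant ([ae_com_index]); and it
      depends only on the image of N, so that its kernel is closed
      ([closure_sub_ker_index]).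
    - Let S have index 0. For the points x of some set of positive measure the
      image M0 of N under Phi S x does not depend on x, and as the index is 0 a
      finitely supported involution of Z maps M0 to N. Performing it around
      the points of a set Z of positive measure, chosen so thin that the supports do
      not overlap, gives an involution P such that P S preserves the half-line
      that starts at each visit to Z. By recurrence P S preserves a partition
      of almost every orbit into finite intervals, so that it has finite cycles and
      is a product of two involutions ([index0_finite_cycles]). *)

(** * Measurability of countable formulas *)

Section measurable_formulas.
Context d (X : measurableType d).
Implicit Types P Q : X -> Prop.

Lemma measurable_ex (I : countType) (P : I -> X -> Prop) :
  (forall i, measurable [set x | P i x]) -> measurable [set x | exists i, P i x].
Proof.
move=> mP; have -> : [set x | exists i, P i x] = \bigcup_i [set x | P i x].
  by apply/seteqP; split => x /= [i]; exists i.
exact: countable_bigcupT_measurable.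
Qed.

Lemma measurable_not P : measurable [set x | P x] -> measurable [set x | ~ P x].
Proof. exact: measurableC. Qed.

Lemma measurable_all (I : countType) (P : I -> X -> Prop) :
  (forall i, measurable [set x | P i x]) -> measurable [set x | forall i, P i x].
Proof.
move=> mP.
have -> : [set x | forall i, P i x] = ~` [set x | exists i, ~ P i x].
  apply/seteqP; split => x /=; first by move=> h [i]; apply; exact: h.
  by move=> h i; apply: contrapT => n; apply: h; exists i.
by apply: measurableC; apply: measurable_ex => i; exact: measurable_not.
Qed.

Lemma measurable_and P Q : measurable [set x | P x] ->
  measurable [set x | Q x] -> measurable [set x | P x /\ Q x].
Proof. exact: measurableI. Qed.

Lemma measurable_or P Q : measurable [set x | P x] ->
  measurable [set x | Q x] -> measurable [set x | P x \/ Q x].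
Proof. exact: measurableU. Qed.

Lemma measurable_prop (p : Prop) : measurable [set x : X | p].
Proof.
have [h|h] := pselect p.
  by rewrite (_ : [set _ | _] = setT) //; apply/seteqP; split.
by rewrite (_ : [set _ | _] = set0) //; apply/seteqP; split.
Qed.

Lemma measurable_imp P Q : measurable [set x | P x] ->
  measurable [set x | Q x] -> measurable [set x | P x -> Q x].
Proof.
move=> mP mQ; have -> : [set x | P x -> Q x] = [set x | ~ P x \/ Q x].
  apply/seteqP; split => x /=; last by case.
  by move=> h; have [p|p] := pselect (P x); [right; exact: h | left].
by apply: measurable_or => //; exact: measurable_not.
Qed.

Lemma measurable_iff P Q : measurable [set x | P x] ->
  measurable [set x | Q x] -> measurable [set x | P x <-> Q x].
Proof. by move=> mP mQ; apply: measurable_and; apply: measurable_imp. Qed.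

(** A function with values in a countable set is treated through its level
    sets: a formula about its value is a countable disjunction. *)
Lemma measurable_level (I : countType) (c : X -> I) (P : I -> X -> Prop) :
  (forall i, measurable [set x | c x = i]) ->
  (forall i, measurable [set x | P i x]) -> measurable [set x | P (c x) x].
Proof.
move=> mc mP.
have -> : [set x | P (c x) x] = [set x | exists i, c x = i /\ P i x].
  by apply/seteqP; split => x /=; [exists (c x) | case=> i [-> ]].
by apply: measurable_ex => i; exact: measurable_and.
Qed.

(** Measurable selection among countably many values, by taking the first one
    in an enumeration. *)
Lemma measurable_select (I : countType) (i0 : I) (D : I -> set X) :
  (forall i, measurable (D i)) ->
  exists c : X -> I, (forall i, measurable [set x | c x = i]) /\
    forall x, (exists i, D i x) -> D (c x) x.
Proof.
move=> mD.
pose first i x := D i x /\ forall j, (choice.pickle j < choice.pickle i)%N -> ~ D j x.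
have first_uniq i j x : first i x -> first j x -> i = j.
  move=> [Di hi] [Dj hj]; apply: (pcan_inj choice.pickleK).
  by case: (ltngtP (choice.pickle i) (choice.pickle j)) => // [/hj|/hi].
have first_ex x : (exists i, D i x) -> exists i, first i x.
  move=> [i Di]; pose p n := `[< exists j, choice.pickle j = n /\ D j x >].
  have /ex_minnP[n /asboolP[j [jn Dj]] nmin] : exists n, p n.
    by exists (choice.pickle i); apply/asboolP; exists i.
  exists j; split => // k; rewrite jn ltnNge => /negP kn Dk; apply: kn.
  by apply: nmin; apply/asboolP; exists k.
exists (fun x => xget i0 [set i | first i x]); split; last first.
  by move=> x /first_ex[i fi]; case: xgetP => [j _ []|/(_ i)].
move=> i.
have -> : [set x | xget i0 [set i | first i x] = i] =
    [set x | first i x \/ i = i0 /\ ~ exists j, first j x].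
  apply/seteqP; split => x /=.
    case: xgetP => [j _ fj <-|h]; first by left.
    by move=> <-; right; split => // -[j fj]; exact: (h j fj).
  case=> [fi|[-> h]].
    by apply: (first_uniq _ _ x) => //; case: xgetP => [j _ //|/(_ i)].
  by case: xgetP => // j _ fj; case: h; exists j.
have mfirst j : measurable [set x | first j x].
  rewrite /first; apply: measurable_and; first exact: mD.
  apply: measurable_all => k; apply: measurable_imp; first exact: measurable_prop.
  by apply: measurable_not; exact: mD.
apply: measurable_or => //; apply: measurable_and; first exact: measurable_prop.
by apply: measurable_not; exact: measurable_ex.
Qed.

End measurable_formulas.

Section almost_everywhere_formulas.
Context (R : realType) d (X : measurableType d) (mu : probability X R).

Lemma ae_all (I : countType) (P : I -> X -> Prop) :
  (forall i, \forall x \ae mu, P i x) -> \forall x \ae mu, forall i, P i x.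
Proof.
move=> h.
have : \forall x \ae mu, forall n : nat, if choice.unpickle n is Some i then P i x else True.
  apply/ae_foralln => n; case: choice.unpickle => [i|]; first exact: h.
  exact: filterE.
by apply: filterS => x hx i; have := hx (choice.pickle i); rewrite choice.pickleK.
Qed.

Lemma ae_null (A : set X) : measurable A ->
  mu A = 0%E <-> \forall x \ae mu, ~ A x.
Proof.
move=> mA; rewrite -negligibleP //; split => -[N [mN N0 sN]]; exists N; split=> //.
  by move=> x /= /contrapT; exact: sN.
by move=> x Ax; apply: sN => /=; apply.
Qed.

Lemma positive_piece (I : countType) (A : set X) (D : I -> set X) :
  measurable A -> mu A <> 0%E -> (forall i, measurable (D i)) ->
  (\forall x \ae mu, A x -> exists i, D i x) -> exists i, mu (A `&` D i) <> 0%E.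
Proof.
move=> mA A0 mD cov; apply: contrapT => h; apply: A0; apply/ae_null => //.
have nD : \forall x \ae mu, forall i, ~ (A `&` D i) x.
  apply: ae_all => i; apply/ae_null; first exact: measurableI.
  by apply: contrapT => n; apply: h; exists i.
by apply: filterS2 cov nD => x cx hx Ax; have [i Di] := cx Ax; exact: (hx i).
Qed.

Lemma ae_exists (P : X -> Prop) : (\forall x \ae mu, P x) -> exists x, P x.
Proof.
move=> h; have m0 : (0 < mu setT)%E by rewrite probability_setT lte01.
have pf := ae_properfilter_algebraOfSetsType m0.
exact: (@filter_ex _ _ pf).
Qed.

End almost_everywhere_formulas.

(** * Integer iterates *)

Section iterates.
Context (R : realType) d (X : measurableType d) (mu : probability X R).
Variable t : nsbij mu.
Implicit Types (n m : int) (x : X).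

Lemma iterz0 x : iterz t 0 x = x. Proof. by []. Qed.

Lemma iterz1 n x : iterz t (n + 1) x = t (iterz t n x).
Proof.
case: n => [k|[|k]].
- by rewrite (_ : Posz k + 1 = Posz k.+1) //; lia.
- by rewrite /= nsinvK.
- by rewrite (_ : Negz k.+1 + 1 = Negz k) /= ?nsinvK //; lia.
Qed.

Lemma iterzB1 n x : iterz t (n - 1) x = nsinv t (iterz t n x).
Proof. by rewrite -{2}(subrK 1 n) iterz1 nsfunK. Qed.

Lemma iterzD m n x : iterz t (m + n) x = iterz t m (iterz t n x).
Proof.
case: m => k; elim: k => [|k IH].
- by rewrite add0r.
- have -> : Posz k.+1 + n = Posz k + n + 1 by lia.
  by rewrite iterz1 IH.
- by rewrite NegzE addrC iterzB1.
- have -> : Negz k.+1 + n = Negz k + n - 1 by lia.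
  by rewrite iterzB1 IH.
Qed.

Lemma iterzK n x : iterz t (- n) (iterz t n x) = x.
Proof. by rewrite -iterzD addNr. Qed.

Lemma measurable_iterz n : measurable_fun setT (iterz t n).
Proof.
have mi (f : X -> X) k : measurable_fun setT f -> measurable_fun setT (iter k f).
  move=> mf; elim: k => [|k IH]; first exact: measurable_id.
  exact: (measurableT_comp mf IH).
by case: n => k; apply: mi; [exact: measurable_nsfun|exact: measurable_nsinv].
Qed.

Lemma measurable_at n (P : X -> Prop) : measurable [set x | P x] ->
  measurable [set x | P (iterz t n x)].
Proof. by move=> mP; rewrite -[X in measurable X]setTI; exact: measurable_iterz. Qed.

Lemma ae_at n (P : X -> Prop) : (\forall x \ae mu, P x) ->
  \forall x \ae mu, P (iterz t n x).
Proof.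
move=> h; have hi (s : nsbij mu) k : \forall x \ae mu, P (iter k s x).
  elim: k => [//|k IH]; apply: filterS (ae_nsbij s IH) => x.
  by rewrite iterSr.
by case: n => k; [exact: hi | exact: (hi (nsbijV t))].
Qed.

Lemma ae_orbit (P : X -> Prop) : (\forall x \ae mu, P x) ->
  \forall x \ae mu, forall n, P (iterz t n x).
Proof. by move=> h; apply: ae_all => n; exact: ae_at. Qed.

End iterates.

(** * Separation of points *)

Section standard_borel_space.
Context (R : realType) d (X : measurableType d) (mu : probability X R).
Hypothesis hX : standard_borel R X.

(** The sequence comes from a countable basis of a Polish topology. *)
Lemma separating_sequence : exists E : nat -> set X,
  (forall m, measurable (E m)) /\ forall x y, x <> y -> exists m, E m x /\ ~ E m y.
Proof.
have [P [f [hP [B cB [Bo Bn]] [g fK gK] mf]]] := hX.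
have [r rinj] := countable_injP _ cB.
pose V m := xget set0 [set U | B U /\ r U = m].
exists (fun m => f @^-1` V m); split=> [m|x y xy].
  apply/mf; rewrite image_preimage; last first.
    by apply/seteqP; split => // y _; exists (g y).
  apply: sub_sigma_algebra; rewrite /V; case: xgetP => [U _ [/Bo]//|_].
  exact: open0.
have /eqP fxy : f x <> f y by move=> /(can_inj fK).
have := hP; rewrite open_hausdorff => /(_ _ _ fxy)[[U W]] /= [+ +] [oU _ /eqP UW].
rewrite !inE => Ux Wy.
have [U' [BU' U'x] sU] := Bn (f x) U (open_nbhs_nbhs (conj oU Ux)).
have VE : V (r U') = U'.
  rewrite /V; case: xgetP => [U2 _ [B2 e]|/(_ U')]; last by case.
  by apply: rinj => //; rewrite inE.
exists (r U'); rewrite /= VE; split => // /sU U'y.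
by have : (U `&` W) (f y) by []; rewrite UW.
Qed.

Lemma measurable_eq_fun (f g : X -> X) : measurable_fun setT f ->
  measurable_fun setT g -> measurable [set x | f x = g x].
Proof.
move=> mf mg; have [E [mE sE]] := separating_sequence.
have -> : [set x | f x = g x] = [set x | forall m, E m (f x) -> E m (g x)].
  apply/seteqP; split => x /=; first by move=> ->.
  by move=> h; apply: contrapT => /sE[m [/h]].
apply: measurable_all => m; apply: measurable_imp;
  rewrite -[X in measurable X]setTI; [exact: mf|exact: mg].
Qed.

Variable t : nsbij mu.

(** When x differs from its image, some set of a separating sequence contains x
    but not the image. The points for which a given set does so form a set
    disjoint from its translate, and these countably many sets cover Y. *)
Lemma disjoint_translates (J : seq int) (Y : set X) : measurable Y ->
  mu Y <> 0%E -> (forall x j, Y x -> j \in J -> iterz t j x <> x) ->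
  exists Z, [/\ measurable Z, mu Z <> 0%E, Z `<=` Y &
    forall x j, j \in J -> Z x -> ~ Z (iterz t j x)].
Proof.
move=> + + hJ; have [E [mE sE]] := separating_sequence.
elim: J Y hJ => [|j J IH] Y hJ mY Y0; first by exists Y; split.
have [|Z [mZ Z0 ZY hZ]] := IH Y _ mY Y0.
  by move=> x i Yx iJ; apply: hJ; rewrite // inE iJ orbT.
pose D m := [set x | E m x /\ ~ E m (iterz t j x)].
have mD m : measurable (D m).
  apply: measurable_and; first exact: mE.
  by apply: measurable_not; apply: measurable_at; exact: mE.
have [|m Dm] := positive_piece mZ Z0 mD.
  apply: filterE => x Zx; apply: sE => /esym; apply: hJ; first exact: ZY.
  by rewrite inE eqxx.
exists (Z `&` D m); split => //.
- exact: measurableI.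
- by move=> x [/ZY].
move=> x i; rewrite inE => /predU1P[->|iJ] [Zx [Ex nE]] [Zix [Eix _]] //.
exact: (hZ x i).
Qed.

End standard_borel_space.

(** * Orbits of an ergodic transformation *)

Section ergodic_orbits.
Context (R : realType) d (X : measurableType d) (mu : probability X R).
Variable T : Aut mu.
Hypotheses (hX : standard_borel R X) (hmu : atomless mu) (hT : ergodic T).
Local Notation t := (Aut_repr T).

Definition saturation (A : set X) : set X := [set x | exists n, A (iterz t n x)].

Lemma measurable_saturation A : measurable A -> measurable (saturation A).
Proof. by move=> mA; apply: measurable_ex => n; exact: measurable_at. Qed.

Lemma saturation_conull A : measurable A -> mu A <> 0%E ->
  \forall x \ae mu, saturation A x.
Proof.
move=> mA A0; have mS := measurable_saturation mA.
have inv : t @^-1` saturation A = saturation A.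
  apply/seteqP; split => x /= [n An].
    by exists (n + 1); rewrite iterzD.
  by exists (n - 1); rewrite -[t x]/(iterz t 1 x) -iterzD subrK.
have [S0|S0] := hT mS inv.
  case: A0; apply/ae_null => //; have /(ae_null mu mS) := S0.
  by apply: filterS => x nS Ax; apply: nS; exists 0.
have /(ae_null mu (measurableC mS)) := S0.
by apply: filterS => x /contrapT.
Qed.

(** Otherwise Z, not being an atom, would split into two pieces of positive
    measure with disjoint saturations, which are both conull. *)
Lemma null_partial_section (Z : set X) : measurable Z ->
  (forall x n, Z x -> Z (iterz t n x) -> iterz t n x = x) -> mu Z = 0%E.
Proof.
move=> mZ uZ; apply: contrapT => Z0.
apply: (hmu (A := Z)); split => // [|B mB BZ].
  by rewrite lt_neqAle measure_ge0 eq_sym andbT; exact/eqP.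
apply: contrapT => /not_orP[B0 BZn].
pose C := Z `\` B.
have mC : measurable C by exact: measurableD.
have C0 : mu C <> 0%E.
  move=> C0; apply: BZn; rewrite -[in RHS](setDUK BZ) measureU //.
    by rewrite [X in (_ + X)%E]C0 adde0.
  by apply/seteqP; split => x // -[Bx [_ nB]].
have [x [[n Bx] [m [Zx nBx]]]] := ae_exists
  (filterI (saturation_conull mB B0) (saturation_conull mC C0)).
apply: nBx; have := uZ _ (m - n) (BZ _ Bx).
by rewrite -iterzD subrK => -> //.
Qed.

(** A set of positive measure made of points of exact period n.+1 would contain a
    piece Z of positive measure disjoint from its n first translates, and
    such a Z meets every orbit at most once. *)
Lemma ae_aperiodic : \forall x \ae mu, forall n, n != 0 -> iterz t n x <> x.
Proof.
have mP n : measurable [set x | iterz t n x = x].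
  apply: (measurable_eq_fun hX (f := iterz t n) (g := id)).
    exact: measurable_iterz.
  exact: measurable_id.
pose Q (n : nat) x := iterz t n.+1 x = x /\
  forall i, (i < n)%N -> iterz t i.+1 x <> x.
have mQ n : measurable [set x | Q n x].
  apply: measurable_and; first exact: mP.
  apply: measurable_all => i; apply: measurable_imp; first exact: measurable_prop.
  by apply: measurable_not; exact: mP.
have Q0 n : mu [set x | Q n x] = 0%E.
  apply: contrapT => Qn0; pose J : seq int := [seq Posz i.+1 | i <- iota 0 n].
  have [|Z [mZ Z0 ZQ hZ]] := disjoint_translates hX (t := t) (J := J) (mQ n) Qn0.
    move=> x j [_ h] /mapP[i]; rewrite mem_iota => /andP[_ iN] ->.
    exact: h.
  apply: Z0; apply: null_partial_section => // x m Zx Zm.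
  have [Qx _] := ZQ _ Zx.
  have per q : iterz t (q * n.+1%:Z) x = x.
    case: q => q; elim: q => [|q IH].
    - by rewrite mul0r.
    - rewrite (_ : Posz q.+1 * _ = q%:Z * n.+1%:Z + n.+1%:Z); last by lia.
      by rewrite iterzD Qx.
    - rewrite (_ : Negz 0 * n.+1%:Z = - n.+1%:Z); last by lia.
      by rewrite -{1}Qx iterzK.
    - rewrite (_ : Negz q.+1 * _ = Negz q * n.+1%:Z - n.+1%:Z); last by lia.
      by rewrite iterzD -{1}Qx iterzK.
  have em : iterz t m x = iterz t (m %% n.+1)%Z x.
    by rewrite {1}(divz_eq m n.+1) addrC iterzD per.
  have r0 : (0 <= m %% n.+1)%Z by rewrite modz_ge0.
  have rn : (m %% n.+1 < n.+1)%Z by rewrite ltz_pmod.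
  rewrite em in Zm *; case: (m %% n.+1)%Z r0 rn Zm => // -[//|r] _ rn Zm.
  exfalso; apply: (hZ x r.+1) => //; apply: map_f.
  by rewrite mem_iota /=; lia.
have : \forall x \ae mu, forall n, ~ Q n x.
  by apply: ae_all => n; apply/(ae_null mu (mQ n)).
apply: filterS => x nQ.
have pos n : iterz t n.+1 x <> x.
  by elim/ltn_ind: n => n IH e; apply: (nQ n); split.
case=> [[|n]|n] // _ e.
by apply: (pos n); rewrite -{1}e NegzE -iterzD subrr.
Qed.

Lemma iterz_inj x : (forall n, n != 0 -> iterz t n x <> x) ->
  injective (iterz t ^~ x).
Proof.
move=> ap m n /= e; apply/eqP; rewrite -subr_eq0; apply/negPn/negP => /ap; apply.
by rewrite addrC iterzD e iterzK.
Qed.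

(** The points of A that are the last, or the first, of their orbit in A form a
    set that meets every orbit at most once, hence are negligible. *)
Lemma ae_recurrent A : measurable A -> mu A <> 0%E ->
  \forall x \ae mu, forall n, (exists2 m, n <= m & A (iterz t m x)) /\
    (exists2 m, m <= n & A (iterz t m x)).
Proof.
move=> mA A0.
(* s is 1 for the last visits and -1 for the first ones. *)
pose last (s : int) x := A x /\ forall k : nat, ~ A (iterz t (s * k.+1%:Z) x).
have mlast s : measurable [set x | last s x].
  apply: measurable_and; first exact: mA.
  apply: measurable_all => k; apply: measurable_not; exact: measurable_at.
have last0 s : s = 1 \/ s = -1 -> mu [set x | last s x] = 0%E.
  move=> s1; apply: null_partial_section => // x n [Ax hx] [Anx hnx].
  case: (ltrgtP (s * n) 0) => sn; last by rewrite (_ : n = 0) //; lia.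
    exfalso; apply: (hnx (absz n).-1); rewrite -iterzD.
    by rewrite (_ : s * _ + n = 0) //; lia.
  exfalso; apply: (hx (absz n).-1).
  by rewrite (_ : s * _ = n) //; lia.
have nolast s : s = 1 \/ s = -1 -> \forall x \ae mu, forall n, ~ last s (iterz t n x).
  move=> /last0 h; apply: (@ae_orbit _ _ _ _ _ (fun x => ~ last s x)).
  exact/(ae_null mu (mlast s)).
have h1 := nolast 1 (or_introl erefl); have h2 := nolast (-1) (or_intror erefl).
apply: filterS3 (saturation_conull mA A0) h1 h2 => x [m Am] l1 l2.
have run s : (forall n, ~ last s (iterz t n x)) ->
    forall k : nat, exists i : nat, (k <= i)%N /\ A (iterz t (s * i%:Z + m) x).
  move=> ls; elim=> [|k [i [ki Ai]]]; first by exists 0%N; rewrite mulr0 add0r.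
  have [j Aj] : exists j : nat, A (iterz t (s * j.+1%:Z) (iterz t (s * i%:Z + m) x)).
    apply: contrapT => nj; apply: (ls (s * i%:Z + m)); split => // j Aj.
    by apply: nj; exists j.
  exists (i + j.+1)%N; split; first by lia.
  by move: Aj; rewrite -iterzD addrA -mulrDr -PoszD addnC.
move=> n; split.
  have [i [ki Ai]] := run 1 l1 `|n - m|%N.
  by exists (1 * i%:Z + m) => //; lia.
have [i [ki Ai]] := run (-1) l2 `|n - m|%N.
by exists (-1 * i%:Z + m) => //; lia.
Qed.

End ergodic_orbits.

(** * Commensurating permutations and their index *)

Section commensurating_permutations.
Implicit Types (s u r : int -> int) (M : set int) (n m : int).

Definition crossing M s : set int := [set n | ~ (M n <-> M (s n))].

(** The permutation s maps its crossings of N onto the symmetric difference of N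
    and its image. *)
Lemma is_symZNP s : is_symZN s <-> bijective s /\ finite_set (crossing Nset s).
Proof.
have E : bijective s -> (s @` Nset) `+` Nset = s @` crossing Nset s.
  move=> bs; have si := bij_inj bs; have [r rK sK] := bs.
  rewrite setY_def; apply/seteqP; split => m /=.
    move=> [[[n Nn <-] nN]|[Nm nm]].
      by exists n => // h; apply: nN; apply/h.
    exists (r m) => //; rewrite /crossing /= sK => h; apply: nm.
    by exists (r m); [apply/h|].
  move=> [n h <-]; rewrite /crossing /= in h.
  have [Nn|nN] := pselect (Nset n); [left|right]; split.
  - by exists n.
  - by move=> Ns; apply: h.
  - by apply: contrapT => nNs; apply: h.
  - by move=> [k Nk /si kn]; rewrite kn in Nk.
split => -[bs fs]; split => //; last by rewrite E //; exact: finite_image.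
rewrite E // in fs; have := finite_preimage (f := s) (B := s @` crossing Nset s).
have -> : s @^-1` (s @` crossing Nset s) = crossing Nset s.
  apply/seteqP; split => n /=; last by exists n.
  by move=> [k hk /(bij_inj bs) <-].
by apply => // x y _ _ /(bij_inj bs).
Qed.

Lemma finite_crossing s M : is_symZN s -> CommN M -> finite_set (crossing M s).
Proof.
move=> /is_symZNP[bs fs] fM.
apply: (@sub_finite_set _ _ (crossing Nset s `|` ((M `+` Nset) `|` s @^-1` (M `+` Nset)))).
  move=> n /= h; apply: contrapT => /not_orP[/contrapT hN /not_orP[n1 n2]].
  have e k : ~ (M `+` Nset) k -> (M k <-> Nset k).
    rewrite setY_def => /not_orP[k1 k2]; split => hk; apply: contrapT => hn.
      exact: k1.
    exact: k2.
  by apply: h; rewrite (e n n1) (e (s n) n2).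
rewrite finite_setU; split => //; rewrite finite_setU; split => //.
by apply: finite_preimage => // x y _ _ /(bij_inj bs).
Qed.

Lemma CommN_Nset : CommN Nset. Proof. by rewrite /CommN /= setYK. Qed.

Lemma is_symZN_comp s u : is_symZN s -> is_symZN u -> is_symZN (s \o u).
Proof.
move=> /is_symZNP[bs fs] /is_symZNP[bu fu].
apply/is_symZNP; split; first exact: bij_comp.
apply: (@sub_finite_set _ _ (crossing Nset u `|` u @^-1` crossing Nset s)).
  move=> n /= h; apply: contrapT => /not_orP[/contrapT h1 /contrapT h2].
  by apply: h; rewrite h1.
rewrite finite_setU; split => //.
by apply: finite_preimage => // x y _ _ /(bij_inj bu).
Qed.

Lemma is_symZN_inv s r : is_symZN s -> cancel s r -> cancel r s -> is_symZN r.
Proof.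
move=> /is_symZNP[bs fs] sr rs; apply/is_symZNP; split; first by exists s.
have -> : crossing Nset r = r @^-1` crossing Nset s.
  by apply/seteqP; split => n /=; rewrite /crossing /= rs => h e; apply: h; split => /e.
by apply: finite_preimage => // x y _ _ /(can_inj rs).
Qed.

Lemma CommN_image s M : is_symZN s -> CommN M -> CommN (s @` M).
Proof.
move=> hs fM; have [_ fs] := hs.
apply: (@sub_finite_set _ _ (s @` (M `+` Nset) `|` ((s @` Nset) `+` Nset))).
  move=> n; rewrite !setY_def => -[[[m Mm <-] nN]|[Nn nM]].
    have [Nm|nm] := pselect (Nset m); last by left; exists m => //; left.
    by right; left; split => //; exists m.
  have [[m Nm e]|nm] := pselect ((s @` Nset) n); last by right; right.
  left; exists m => //; right; split => // Mm; apply: nM.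
  by exists m.
by rewrite finite_setU; split => //; exact: finite_image.
Qed.

(** Only the integers at distance at most K of 0 can cross. *)
Lemma is_symZN_bounded s (K : nat) : bijective s ->
  (forall n, (`|s n - n| <= K)%N) -> is_symZN s.
Proof.
move=> bs hK; apply/is_symZNP; split => //.
apply: (@sub_finite_set _ _ ((fun k : nat => k%:Z - K%:Z) @` `I_(K.*2.+1))).
  move=> n /= h; have := hK n => hn; exists (absz (n + K%:Z)).
    rewrite /Nset /crossing /= in h.
    have : ~ ((0 <= n) = (0 <= s n)) by move=> e; apply: h; rewrite /Nset /= e.
    by lia.
  rewrite /Nset /crossing /= in h.
  have : ~ ((0 <= n) = (0 <= s n)) by move=> e; apply: h; rewrite /Nset /= e.
  by lia.
by apply: finite_image; exact: finite_II.
Qed.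

Lemma is_symZN_sub s u : is_symZN u -> bijective s ->
  (forall n, s n = n \/ s n = u n) -> is_symZN s.
Proof.
move=> /is_symZNP[_ fu] bs h; apply/is_symZNP; split => //.
by apply: sub_finite_set fu => n; rewrite /crossing /=; case: (h n) => -> // nn; case: nn.
Qed.

(** The index, as a sum in which changes of variables are available. *)
Definition nonneg n : int := (nat_of_bool (0 <= n)%R)%:Z.
Definition zindex s : int := \sum_(n \in [set: int]) (nonneg (s n) - nonneg n).

Lemma nonneg_support s : (fun n => nonneg (s n) - nonneg n) @^-1` [set~ 0]
  `<=` crossing Nset s.
Proof.
move=> n /= h e; apply: h; rewrite /nonneg.
suff -> : (0 <= s n) = (0 <= n) by rewrite subrr.
by apply/idP/idP => /e.
Qed.

Lemma symZN_index_sum (s : symZN) : symZN_index s = zindex s.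
Proof.
have [[r rK sK] fs] := symZNP s.
have fA : finite_set (Nset `\` s @` Nset).
  by apply: sub_finite_set fs; rewrite setY_def => x; right.
have fB : finite_set (s @` Nset `\` Nset).
  by apply: sub_finite_set fs; rewrite setY_def => x; left.
have sN m : (s @` Nset) m <-> 0 <= r m.
  by split => [[k Nk <-]|h]; [rewrite rK | exists (r m)].
rewrite /zindex [RHS](@reindex_fsbigT _ _ _ _ _ r); last by exists s.
under eq_fsbigr do rewrite sK.
rewrite -(@fsbig_widen _ _ _ _ ((Nset `\` s @` Nset) `|` (s @` Nset `\` Nset))) //.
  rewrite fsbigU0 //; last by move=> x [[_ h] [/h]].
  have card (A : set int) : finite_set A -> \sum_(i \in A) (1 : int) = #|` fset_set A|%:Z.
    by move=> fA'; rewrite (@fsbig_finite _ _ _ _ A (fun=> 1)) // card_fset_sum1 -natz natr_sum.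
  rewrite /symZN_index -!card //; congr (_ + _).
    apply: eq_fsbigr => m; rewrite inE => -[Nm /sN]; rewrite /nonneg /Nset /= in Nm *.
    by rewrite Nm => /negP/negbTE ->.
  rewrite -mulN1r mulr_fsumr; apply: eq_fsbigr => m; rewrite inE => -[/sN].
  by rewrite /nonneg /Nset /= => -> /negP/negbTE ->.
move=> m [_ /not_orP[h1 h2]] /=; rewrite /nonneg.
suff -> : (0 <= r m) = (0 <= m) by rewrite subrr.
apply/idP/idP => h; apply: contrapT => n.
  by apply: h2; split => //; apply/sN.
by apply: h1; split => // /sN.
Qed.

(** The sum of the left-hand side telescopes, and u is a change of variables. *)
Lemma zindex_comp s u : is_symZN s -> is_symZN u ->
  zindex (s \o u) = zindex s + zindex u.
Proof.
move=> /is_symZNP[bs fs] /is_symZNP[bu fu].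
rewrite /zindex [in X in X + _](@reindex_fsbigT _ _ _ _ _ u) //.
pose P := u @^-1` crossing Nset s `|` crossing Nset u.
have fP : finite_set P.
  rewrite finite_setU; split => //.
  by apply: finite_preimage => // x y _ _ /(bij_inj bu).
have h1 n : ~ P n -> nonneg (s (u n)) - nonneg (u n) = 0.
  by move=> /not_orP[h _]; apply: contrapT => /(@nonneg_support s (u n)).
have h2 n : ~ P n -> nonneg (u n) - nonneg n = 0.
  by move=> /not_orP[_ h]; apply: contrapT => /(@nonneg_support u n).
rewrite -!(@fsbig_widen _ _ _ _ P [set: int]) //; last 3 first.
- by move=> n [_ /h2].
- by move=> n [_ /h1].
- by move=> n [_ Pn] /=; rewrite -(subrK (nonneg (u n)) (nonneg (s _))) -addrA h1 // h2.
by rewrite -fsbig_split //; apply: eq_fsbigr => n _ /=; rewrite addrA subrK.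
Qed.

Lemma zindex_id : zindex id = 0.
Proof. by apply: fsbig1 => n _; rewrite subrr. Qed.

Lemma is_symZN_shift (k : int) : is_symZN (fun n => n + k).
Proof.
apply: (@is_symZN_bounded _ `|k|%N); last by move=> n; rewrite addrC addKr.
by exists (fun n => n - k) => n; rewrite ?addrK ?subrK.
Qed.

(** The two translations have opposite indices. *)
Lemma zindex_shift s (k : int) : is_symZN s -> zindex (fun n => s (n + k) - k) = zindex s.
Proof.
move=> hs; have h1 := is_symZN_shift k; have h2 := is_symZN_shift (- k).
have -> : (fun n => s (n + k) - k) = (fun n => n - k) \o (s \o (fun n => n + k)) by [].
rewrite zindex_comp //; last exact: is_symZN_comp.
rewrite (zindex_comp hs h1) addrCA -zindex_comp //.
have -> : (fun n => n - k) \o (fun n => n + k) = id by apply/funext => n /=; rewrite addrK.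
by rewrite zindex_id addr0.
Qed.

End commensurating_permutations.

(** * Reflections of finite cycles *)

Lemma finite_orbit_cycle (I : Type) (f : I -> I) (x : I) : injective f ->
  finite_set (range (fun k => iter k f x)) -> exists2 p, (0 < p)%N & iter p f x = x.
Proof.
move=> fi fin; apply: contrapT => h.
have inj : injective (fun k => iter k f x).
  suff lt i j : (i < j)%N -> iter i f x <> iter j f x.
    move=> i j e; case: (ltngtP i j) => // /lt; first by case.
    by move=> ne; case: ne.
  move=> ij e; apply: h; exists (j - i)%N; first by rewrite subn_gt0.
  have fin_i : injective (iter i f) by elim: i {ij e} => [//|i IH] y z /= /fi/IH.
  by apply: fin_i; rewrite -iterD subnKC // ltnW.
apply: infinite_nat; have := finite_preimage (f := fun k => iter k f x) _ fin.
rewrite (_ : _ @^-1` _ = setT); first by apply => i j _ _; exact: inj.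
by apply/seteqP; split => // k _ /=; exists k.
Qed.

Section reversal.
Variable s : int -> int.
Hypotheses (s_inj : injective s)
  (s_per : forall n, exists2 p, (0 < p)%N & iter p s n = n).
Implicit Types n m j : int.

(** The reflection of a u-cycle that fixes its least element m, as a relation. This
    form is equivariant under translations of Z, and visibly measurable in u. *)
Definition reflected (u : int -> int) n j : Prop :=
  exists m i, [/\ iter i u m = n, iter i u j = m & forall k : nat, m <= iter k u m].

Let iter_inj i : injective (iter i s).
Proof. by elim: i => [//|i IH] y z /= /s_inj/IH. Qed.

Let iter_per p n k : iter p s n = n -> iter (k * p) s n = n.
Proof. by move=> e; elim: k => [//|k IH]; rewrite mulSn iterD IH. Qed.

Let back i m n : iter i s m = n -> exists q, iter q s n = m.
Proof.
move=> <-; have [p p0 pm] := s_per m; exists (i * p.-1)%N.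
by rewrite -iterD addnC -mulnS prednK //; exact: iter_per.
Qed.

Let least n : exists m i, iter i s m = n /\ forall k : nat, m <= iter k s m.
Proof.
have [p p0 pn] := s_per n.
pose k0 := [arg min_(k < Ordinal p0) iter k s n]%O.
have k0min k : iter k0 s n <= iter k s n.
  rewrite /k0; case: arg_minP => // i _ h.
  have kp : (k %% p < p)%N by rewrite ltn_mod.
  have := h (Ordinal kp) isT => /= /le_trans; apply.
  by rewrite {2}(divn_eq k p) addnC iterD (iter_per _ pn).
have [q qn] := back (erefl (iter k0 s n)).
by exists (iter k0 s n), q; split => // k; rewrite -iterD.
Qed.

Lemma reflected_ex n : exists j, reflected s n j.
Proof.
have [m [i [mn lm]]] := least n; have [q qm] := back mn.
have [r rm] := back (erefl (iter i s m)).
by exists (iter r s m), m, i; split => //; rewrite -iterD addnC iterD.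
Qed.

Lemma reflected_uniq n j k : reflected s n j -> reflected s n k -> j = k.
Proof.
move=> [m [i [mn jm lm]]] [m' [i' [mn' km lm']]].
have [q qm] := back mn; have [q' qm'] := back mn'.
have e : m = m'.
  apply/eqP; rewrite eq_le; apply/andP; split.
    by rewrite -qm' -mn -iterD.
  by rewrite -qm -mn' -iterD.
rewrite -{m' qm' lm'}e in mn' km; apply: (@iter_inj (i + i')).
by rewrite [in RHS]iterD km mn addnC iterD jm mn'.
Qed.

Lemma reflected_sym n j : reflected s n j -> reflected s j n.
Proof.
move=> [m [i [mn jm lm]]]; have [p p0 pm] := s_per m.
exists m, (i * p.-1)%N; split => //.
  apply: (@iter_inj i); rewrite -iterD -mulnS prednK // jm.
  exact: iter_per.
by rewrite -mn -iterD addnC -mulnS prednK //; exact: iter_per.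
Qed.

(** Reflecting and then turning one step further is again a reflection, hence
    an involution. *)
Lemma reflected_step n j k : reflected s n j -> reflected s (s j) k -> s k = n.
Proof.
move=> [m [i [mn jm lm]]] jk; have [p p0 pm] := s_per m.
have ep : (i + p).-1.+1 = (i + p)%N by rewrite prednK // addn_gt0 p0 orbT.
rewrite (reflected_uniq jk (k := iter (i + p).-1 s m)).
  by rewrite -iterS ep iterD pm.
apply: reflected_sym; exists m, (i + p).-1; split => //.
by rewrite -iterSr ep addnC iterD jm.
Qed.

Lemma reflected_cycle n j : reflected s n j -> exists k, iter k s n = j.
Proof.
move=> h; have [m [i [mj nm _]]] := reflected_sym h; exists (i + i)%N.
by rewrite iterD nm.
Qed.

(** A cycle that contains a crossing of u contains one of s, and the crossings of
    s meet finitely many cycles. *)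
Lemma is_symZN_cycles (u : int -> int) : is_symZN s -> bijective u ->
  (forall n, exists k, iter k s n = u n) -> is_symZN u.
Proof.
move=> /is_symZNP[bs fs] bu h; apply/is_symZNP; split => //.
apply: (@sub_finite_set _ _
    (\bigcup_(c in crossing Nset s) range (fun k => iter k s c))).
  move=> n un; have [k kn] := h n.
  have [i hi] : exists i, crossing Nset s (iter i s n).
    apply: contrapT => nh; apply: un; rewrite -kn.
    have : forall i, Nset n <-> Nset (iter i s n).
      elim=> [//|i IH]; apply: (iff_trans IH).
      by apply: contrapT => hi; apply: nh; exists i.
    exact.
  have [q qn] := back (erefl (iter i s n)).
  by exists (iter i s n) => //; exists q.
apply: bigcup_finite => // c _; have [p p0 pc] := s_per c.
apply: (@sub_finite_set _ _ ((fun k => iter k s c) @` `I_p)).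
  move=> _ [k _ <-]; exists (k %% p)%N; first by rewrite /= ltn_mod.
  by rewrite [in RHS](divn_eq k p) addnC iterD (iter_per _ pc).
by apply: finite_image; exact: finite_II.
Qed.

End reversal.

(** The two finite sets are exchanged along their enumerations. *)
Lemma swap_to_Nset (M : set int) : CommN M ->
  #|` fset_set (Nset `\` M)| = #|` fset_set (M `\` Nset)| ->
  exists tau : int -> int, [/\ involutive tau,
    exists K : nat, forall n, (K < `|n|)%N -> tau n = n &
    forall n, M n <-> 0 <= tau n].
Proof.
move=> fM; have fA : finite_set (Nset `\` M).
  by apply: sub_finite_set fM => x; rewrite setY_def; right.
have fB : finite_set (M `\` Nset).
  by apply: sub_finite_set fM => x; rewrite setY_def; left.
move: (fset_uniq (fset_set (Nset `\` M))) (fset_uniq (fset_set (M `\` Nset))).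
have inA n : n \in fset_set (Nset `\` M) <-> 0 <= n /\ ~ M n.
  by rewrite in_fset_set // inE.
have inB n : n \in fset_set (M `\` Nset) <-> M n /\ ~ 0 <= n.
  by rewrite in_fset_set // inE.
move: inA inB.
set e := enum_fset (fset_set (Nset `\` M)).
set f := enum_fset (fset_set (M `\` Nset)).
rewrite -/e -/f => inA inB ue uf ef.
have {}inA n : n \in e <-> 0 <= n /\ ~ M n by exact: inA.
have {}inB n : n \in f <-> M n /\ ~ 0 <= n by exact: inB.
have ef0 n : n \in e -> n \in f = false.
  by move=> /inA[n0 _]; apply/negP => /inB[_].
pose tau n := if n \in e then f`_(index n e) else
  if n \in f then e`_(index n f) else n.
have te n : n \in e -> tau n = f`_(index n e) /\ tau n \in f.
  by move=> ne; rewrite /tau ne; split => //; rewrite mem_nth // -ef index_mem.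
have tf n : n \in f -> tau n = e`_(index n f) /\ tau n \in e.
  move=> nf; have -> : tau n = e`_(index n f).
    by rewrite /tau nf; case: ifP => // /ef0; rewrite nf.
  by split => //; rewrite mem_nth // ef index_mem.
exists tau; split.
- move=> n; have [ne|ne] := boolP (n \in e).
    have [e1 h1] := te _ ne; have [-> _] := tf _ h1.
    by rewrite e1 index_uniq ?nth_index // -ef index_mem.
  have [nf|nf] := boolP (n \in f).
    have [e1 h1] := tf _ nf; have [-> _] := te _ h1.
    by rewrite e1 index_uniq ?nth_index // ef index_mem.
  by rewrite /tau (negbTE ne) (negbTE nf) (negbTE ne) (negbTE nf).
- exists (\sum_(i <- e ++ f) `|i|)%N => n nK.
  have nin : n \notin e ++ f.
    by apply/negP => nin; move: nK; rewrite (big_rem n) //= ltnNge leq_addr.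
  by move: nin; rewrite mem_cat negb_or /tau => /andP[/negbTE-> /negbTE->].
move=> n; have [ne|ne] := boolP (n \in e).
  have [_ /inB[_ h]] := te _ ne; have [n0 nM] := (inA n).1 ne.
  by split.
have [nf|nf] := boolP (n \in f).
  by have [_ /inA[h _]] := tf _ nf; have [Mn _] := (inB n).1 nf.
rewrite /tau (negbTE ne) (negbTE nf); split => [Mn|n0]; apply: contrapT => h.
  by move/negP: nf; apply; apply/inB.
by move/negP: ne; apply; apply/inA.
Qed.

(** * The action of the full group on orbits *)

Lemma measurable_class (R : realType) d (X : measurableType d)
    (mu : probability X R) d' (Y : measurableType d') (f : X -> Y) :
  measurable_fun setT f ->
  exists F : {mfun_ mu, X >-> Y}, \forall x \ae mu, F x = f x.
Proof.
move=> mf; pose g : {mfun X >-> Y} := mfun_Sub (mem_set mf).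
exists (\pi_({mfun_ mu, X >-> Y})%qT g).
have /eqmodP/asboolP : (\pi_({mfun_ mu, X >-> Y}) (repr (\pi_({mfun_ mu, X >-> Y}) g))
    = \pi_({mfun_ mu, X >-> Y}) g)%qT by rewrite reprK.
by apply: filterS => x /(_ I).
Qed.

Section action_on_orbits.
Context (R : realType) d (X : measurableType d) (mu : probability X R).
Variable T : Aut mu.
Hypotheses (hX : standard_borel R X) (hmu : atomless mu) (hT : ergodic T).
Local Notation t := (Aut_repr T).
Local Notation phi := (Phi_fun T).
Implicit Types S U : Aut mu.

Lemma ae_cocycle S : full_group T S ->
  \forall x \ae mu, S x = iterz t (cocycle T S x) x.
Proof.
move=> fS; rewrite /cocycle; case: xgetP => [c _ //|noc]; exfalso.
pose D (n : int) := [set x | S x = iterz t n x].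
have [n|c [mc Dc]] := measurable_select (0 : int) (D := D).
  apply: (measurable_eq_fun hX (f := S)); first exact: measurable_nsfun.
  exact: measurable_iterz.
have mfc : measurable_fun setT c.
  move=> _ B _; rewrite setTI.
  rewrite (_ : c @^-1` B = [set x | exists n, B n /\ c x = n]); last first.
    by apply/seteqP; split => x /=; [exists (c x) | case=> n [Bn ->]].
  apply: measurable_ex => n; apply: measurable_and => //.
  exact: measurable_prop.
have [F Fc] := measurable_class mu mfc; apply: (noc F) => /=.
by apply: filterS2 Fc fS => x -> /Dc.
Qed.

Lemma measurable_Phi S n m : measurable [set x | phi S x n = m].
Proof.
have mc k : measurable [set x | cocycle T S x = k].
  rewrite -[X in measurable X]setTI.
  exact: (@measurable_funPT _ _ _ _ (repr (cocycle T S)) _ [set k]).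
rewrite (_ : [set _ | _] = [set x | cocycle T S (iterz t n x) = m - n]).
  exact: (@measurable_at _ _ _ _ T n (fun x => cocycle T S x = m - n) (mc _)).
by apply/seteqP; split => x /=; rewrite /Phi_fun => h; lia.
Qed.

Lemma ae_Phi S : full_group T S -> \forall x \ae mu, forall n m,
  phi S x n = m <-> S (iterz t n x) = iterz t m x.
Proof.
move=> fS; apply: filterS2 (ae_orbit T (ae_cocycle fS)) (ae_aperiodic hX hmu hT).
move=> x cx ap n m; rewrite cx -iterzD /Phi_fun addrC; split=> [->//|].
exact: iterz_inj.
Qed.

Lemma Phi_shift S x k n : phi S (iterz t k x) n = phi S x (n + k) - k.
Proof. by rewrite /Phi_fun -iterzD addrAC addrK. Qed.

Lemma ae_AutM S U : \forall x \ae mu, ((S * U)%g : Aut mu) x = S (U x).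
Proof. exact: Aut_piE. Qed.

Lemma ae_AutV S : \forall x \ae mu, (S^-1%g : Aut mu) x = nsinv S x.
Proof. exact: Aut_piE. Qed.

Lemma ae_Aut1 : \forall x \ae mu, (1%g : Aut mu) x = x.
Proof. exact: (Aut_piE (nsbij1 mu)). Qed.

Lemma Aut_ext S U : (\forall x \ae mu, S x = U x) -> S = U.
Proof. by move=> h; rewrite -[RHS]reprK -[LHS]reprK; apply/Aut_eqP. Qed.

Lemma full_groupM S U : full_group T S -> full_group T U -> full_group T (S * U)%g.
Proof.
move=> fS fU; apply: filterS3 (ae_AutM S U) (ae_nsbij U fS) fU => x ->.
by move=> [n ->] [m ->]; exists (n + m); rewrite iterzD.
Qed.

Lemma full_groupV S : full_group T S -> full_group T S^-1%g.
Proof.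
move=> fS; apply: filterS2 (ae_AutV S) (ae_nsbij (nsbijV S) fS) => x -> /=.
by move=> [n]; rewrite nsinvK => e; exists (- n); rewrite {2}e iterzK.
Qed.

Lemma full_group1 : full_group T 1%g.
Proof. by apply: filterS ae_Aut1 => x ->; exists 0. Qed.

Lemma ae_PhiM S U : full_group T S -> full_group T U ->
  \forall x \ae mu, phi (S * U)%g x = phi S x \o phi U x.
Proof.
move=> fS fU; have fM := full_groupM fS fU.
apply: filterS3 (filterI (ae_Phi fS) (ae_Phi fU)) (ae_Phi fM)
  (ae_orbit T (ae_AutM S U)) => x [hS hU] hM SU.
apply/funext => n /=; apply/hM; rewrite SU.
have /hU -> : phi U x n = phi U x n by [].
exact/hS.
Qed.

Lemma ae_Phi1 : \forall x \ae mu, phi 1%g x = id.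
Proof.
apply: filterS2 (ae_Phi full_group1) (ae_orbit T ae_Aut1) => x h1 h2.
by apply/funext => n; apply/h1; rewrite h2.
Qed.

Lemma ae_PhiV S : full_group T S ->
  \forall x \ae mu, cancel (phi S x) (phi S^-1%g x) /\
    cancel (phi S^-1%g x) (phi S x).
Proof.
move=> fS; have fV := full_groupV fS.
have h1 := ae_PhiM fS fV; have h2 := ae_PhiM fV fS.
rewrite mulgV in h1; rewrite mulVg in h2.
apply: filterS3 h1 h2 ae_Phi1 => x e1 e2 e.
by split => n; [have := congr1 (fun f => f n) e2 | have := congr1 (fun f => f n) e1];
  rewrite e /= => <-.
Qed.

Lemma ae_Phi_bij S : full_group T S -> \forall x \ae mu, bijective (phi S x).
Proof.
by move=> /ae_PhiV; apply: filterS => x [h1 h2]; exists (phi S^-1%g x).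
Qed.

Lemma Phi_eq S U : full_group T S -> full_group T U ->
  (\forall x \ae mu, phi S x = phi U x) -> S = U.
Proof.
move=> fS fU h; apply: Aut_ext; apply: filterS3 (ae_Phi fS) (ae_Phi fU) h.
move=> x hS hU e; have hs := (hS 0 _).1 erefl; have hu := (hU 0 _).1 erefl.
by rewrite -[S x]/(S (iterz t 0 x)) hs e -hu.
Qed.

Local Notation com := (com_full_group T).

Lemma com_full_group1 : com 1%g.
Proof.
split; first exact: full_group1.
by apply: filterS ae_Phi1 => x ->; exact: is_symZN_id.
Qed.

Lemma com_full_groupM S U : com S -> com U -> com (S * U)%g.
Proof.
move=> [fS cS] [fU cU]; split; first exact: full_groupM.
by apply: filterS3 (ae_PhiM fS fU) cS cU => x ->; exact: is_symZN_comp.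
Qed.

Lemma com_full_groupV S : com S -> com S^-1%g.
Proof.
move=> [fS cS]; split; first exact: full_groupV.
by apply: filterS2 (ae_PhiV fS) cS => x [h1 h2] h; exact: (is_symZN_inv h h1 h2).
Qed.

(** The sets commensurate to [Nset], encoded by their symmetric difference with
    it, which makes them a countable family. *)
Definition commN (a : {fset int}) : set int := Nset `+` [set` a].

Lemma CommNP M : CommN M -> exists a, M = commN a.
Proof.
move=> fM; exists (fset_set (M `+` Nset)).
by rewrite /commN fset_setK // setYC -setYA setYK setY0.
Qed.

Lemma CommN_commN a : CommN (commN a).
Proof.
rewrite /CommN /commN /= setYC setYA setYK set0Y.
exact: finite_fset.
Qed.

Lemma measurable_images_eq (s s' : X -> int -> int) M M' :
  (forall n m, measurable [set x | s x n = m]) ->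
  (forall n m, measurable [set x | s' x n = m]) ->
  measurable [set x | s x @` M = s' x @` M'].
Proof.
move=> ms ms'; have mem (f : X -> int -> int) L m :
    (forall n m, measurable [set x | f x n = m]) -> measurable [set x | (f x @` L) m].
  move=> mf; rewrite (_ : [set _ | _] = [set x | exists n, L n /\ f x n = m]).
    apply: measurable_ex => n; apply: measurable_and; last exact: mf.
    exact: measurable_prop.
  by apply/seteqP; split => x /= [n]; [move=> Ln <-|case=> Ln <-]; exists n.
rewrite (_ : [set _ | _] = [set x | forall m, (s x @` M) m <-> (s' x @` M') m]).
  by apply: measurable_all => m; apply: measurable_iff; exact: mem.
apply/seteqP; split => x.
  by move=> e m; exact: (eq_ind _ (fun L : set int => (s x @` M) m <-> L m) _ _ e).
by move=> h; apply/seteqP; split => m /h.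
Qed.

Lemma measurable_image_eq (s : X -> int -> int) M M' :
  (forall n m, measurable [set x | s x n = m]) ->
  measurable [set x | s x @` M = M'].
Proof.
move=> ms; rewrite -(image_id M').
by apply: (measurable_images_eq (s' := fun=> id)) => // n m; exact: measurable_prop.
Qed.

(** An open set is a union of cylinders, prescribing the images of finitely many
    members of [CommN], and there are countably many cylinders. *)
Lemma measurable_to_symZN (f : X -> symZN) :
  (forall n m, measurable [set x | f x n = m]) ->
  measurable_fun setT (f : X -> g_sigma_algebraType (@open symZN)).
Proof.
move=> mf; apply: (measurability (rT := g_sigma_algebraType (@open symZN)) (@open symZN)) => //.
move=> _ [W oW <-]; rewrite setTI.
pose cyl (L : seq ({fset int} * {fset int})) (s : symZN) :=
  forall p, p \in L -> s @` commN p.1 = commN p.2.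
have -> : f @^-1` W = [set x | exists L, (cyl L `<=` W) /\ cyl L (f x)].
  apply/seteqP; split => x /=; last by move=> [L [LW /LW]].
  move=> Wx; have : nbhs (f x) W by exact: open_nbhs_nbhs.
  rewrite -nbhs_entourageE => -[V [F [fF FC] FV] VW].
  have /choice[code codeP] : forall M, exists p : {fset int} * {fset int},
      CommN M -> M = commN p.1 /\ f x @` M = commN p.2.
    move=> M; have [cM|nM] := pselect (CommN M); last by exists (fset0, fset0).
    have [a Ma] := CommNP cM; have [b Mb] := CommNP (CommN_image (symZNP (f x)) cM).
    by exists (a, b).
  have [L FL] : exists L : seq ({fset int} * {fset int}), code @` F = [set` L].
    exact/finite_seqP/finite_image.
  exists L; split.
    move=> s sL; apply: VW; rewrite /xsection /= inE; apply: FV => M FM /=.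
    have [M1 ->] := codeP M (FC _ FM).
    have /sL <- : code M \in L by rewrite -/([set` L] (code M)) -FL; exists M.
    by rewrite -M1.
  move=> p pL; have : [set` L] p by [].
  by rewrite -FL => -[M /FC /codeP[e1 e2] <-]; rewrite -e1.
apply: measurable_ex => L; apply: measurable_and; first exact: measurable_prop.
apply: measurable_all => p; apply: measurable_imp; first exact: measurable_prop.
exact: measurable_image_eq.
Qed.

Lemma ae_Phi_class S : com S ->
  \forall x \ae mu, (Phi T S x : symZN) = phi S x :> (int -> int).
Proof.
move=> [fS cS]; rewrite /Phi; case: xgetP => [f _ //|nof]; exfalso.
(* f takes the value id on a null set that contains all exceptional points. *)
have [N [mN N0 sN]] := cS.
pose f x : symZN := if pselect (is_symZN (phi S x)) is left h then
   if x \in N then SymZN is_symZN_id else SymZN h else SymZN is_symZN_id.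
have fE x : f x = (if x \in N then id else phi S x) :> (int -> int).
  rewrite /f; case: pselect => [h|h]; first by case: ifP.
  have : N x by apply: sN.
  by move=> /mem_set ->.
have [|F Ff] := @measurable_class _ _ _ mu _ _ (f : X -> g_sigma_algebraType (@open symZN)).
  apply: measurable_to_symZN => n m.
  rewrite (_ : [set _ | _] = [set x | N x /\ n = m \/ ~ N x /\ phi S x n = m]).
    apply: measurable_or; apply: measurable_and => //.
    - exact: measurable_prop.
    - exact: measurable_not.
    - exact: measurable_Phi.
  apply/seteqP; split => x /=; rewrite fE.
    have [/set_mem h|/negP h] := boolP (x \in N); first by left.
    by right; split => // /mem_set.
  case=> [[/mem_set ->]|[h]] //; case: ifP => // /set_mem.
  by move/h.
apply: (nof F) => /=; have /(ae_null mu mN) := N0.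
apply: filterS2 Ff => x Fx nN; rewrite -[L0_fun F x]/(F x) Fx fE.
by rewrite memNset.
Qed.

Lemma zindex_image (s s' : int -> int) : is_symZN s -> is_symZN s' ->
  s @` Nset = s' @` Nset -> zindex s = zindex s'.
Proof.
move=> hs hs' e; rewrite -[s]/(SymZN hs : int -> int) -symZN_index_sum.
by rewrite -[s']/(SymZN hs' : int -> int) -symZN_index_sum /symZN_index /= e.
Qed.

Lemma com_positive_image S : com S -> exists M, CommN M /\
  mu [set x | phi S x @` Nset = M] <> 0%E.
Proof.
move=> [_ cS].
have [|||a] := @positive_piece _ _ _ mu _ setT
    (fun a => [set x | phi S x @` Nset = commN a]) measurableT.
- by rewrite probability_setT; case => /eqP; rewrite oner_eq0.
- by move=> a; apply: measurable_image_eq; exact: measurable_Phi.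
- apply: filterS cS => x hx _.
  by apply: CommNP; apply: CommN_image => //; exact: CommN_Nset.
by rewrite setTI; exists (commN a); split => //; exact: CommN_commN.
Qed.

(** Some M is the image of N for all points of a set of positive measure, the
    orbits of which are conull; and along an orbit Phi S x is conjugated by
    translations, which preserves the index. *)
Lemma ae_com_index S : com S -> \forall x \ae mu, zindex (phi S x) = com_index T S.
Proof.
move=> cS; have [fS sS] := cS.
have [M [_ M0]] := com_positive_image cS.
have mM : measurable [set x | phi S x @` Nset = M].
  by apply: measurable_image_eq; exact: measurable_Phi.
have h : \forall x \ae mu, saturation T [set x | phi S x @` Nset = M] x /\
    forall n, is_symZN (phi S (iterz t n x)).
  exact: filterI (saturation_conull hT mM M0) (ae_orbit T sS).
have [x0 [[n0 /= e0] s0]] := ae_exists h.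
have ind : \forall x \ae mu, zindex (phi S x) = zindex (phi S (iterz t n0 x0)).
  apply: filterS h => x [[n /= e] sx].
  rewrite -(zindex_shift (s := phi S x) n); last exact: (sx 0).
  rewrite -[LHS]/(zindex (fun m => phi S x (m + n) - n)).
  have -> : (fun m => phi S x (m + n) - n) = phi S (iterz t n x).
    by apply/funext => m; rewrite Phi_shift.
  by apply: zindex_image; [exact: sx|exact: s0|rewrite e e0].
rewrite /com_index; case: xgetP => [k _ hk|/(_ (zindex (phi S (iterz t n0 x0))))].
  apply: filterS2 hk (ae_Phi_class cS) => x <- e.
  by rewrite symZN_index_sum e.
case; apply: filterS2 ind (ae_Phi_class cS) => x <- e.
by rewrite symZN_index_sum e.
Qed.

Lemma com_indexE S k : com S -> (\forall x \ae mu, zindex (phi S x) = k) ->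
  com_index T S = k.
Proof. by move=> /ae_com_index h1 h2; have [x [<- <-]] := ae_exists (filterI h1 h2). Qed.

Lemma com_indexM S U : com S -> com U ->
  com_index T (S * U)%g = com_index T S + com_index T U.
Proof.
move=> cS cU; apply: com_indexE; first exact: com_full_groupM.
apply: filterS2 (filterI (ae_com_index cS) (ae_com_index cU))
  (filterI (ae_PhiM cS.1 cU.1) (filterI cS.2 cU.2)) => x [<- <-] [-> [hS hU]].
exact: zindex_comp.
Qed.

Lemma com_index1 : com_index T 1%g = 0.
Proof.
apply: com_indexE; first exact: com_full_group1.
by apply: filterS ae_Phi1 => x ->; exact: zindex_id.
Qed.

Lemma com_indexV S : com S -> com_index T S^-1%g = - com_index T S.
Proof.
move=> cS; apply/eqP; rewrite -addr_eq0 -com_indexM //; last exact: com_full_groupV.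
by rewrite mulVg com_index1.
Qed.

End action_on_orbits.

(** * Involutions and finite cycles in the full group *)

Section realization.
Context (R : realType) d (X : measurableType d) (mu : probability X R).
Variable T : Aut mu.
Hypotheses (hX : standard_borel R X) (hmu : atomless mu) (hT : ergodic T).
Local Notation t := (Aut_repr T).
Local Notation phi := (Phi_fun T).
Local Notation com := (com_full_group T).
Implicit Types S U V W : Aut mu.

(** Replacing by zero the jumps that are not undone, one gets an involution
    defined everywhere: the set of points whose jump is undone is invariant. *)
Lemma involution_of_jump (c : X -> int) : (forall n, measurable [set x | c x = n]) ->
  (\forall x \ae mu, c (iterz t (c x) x) = - c x) ->
  exists U, [/\ involution U, full_group T U &
    \forall x \ae mu, forall n, phi U x n = n + c (iterz t n x)].
Proof.
move=> mc hc.
pose good x := c (iterz t (c x) x) = - c x.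
pose c' x := if `[< good x >] then c x else 0.
pose f x := iterz t (c' x) x.
have fT x : good x -> f x = iterz t (c x) x by move=> h; rewrite /f /c' (asboolT h).
have fF x : ~ good x -> f x = x by move=> h; rewrite /f /c' (asboolF h).
have fK : involutive f.
  move=> x; have [gx|ngx] := pselect (good x); last by rewrite !fF.
  have gy : good (iterz t (c x) x) by rewrite /good gx iterzK opprK.
  by rewrite (fT x gx) fT // gx iterzK.
have mgood : measurable [set x | good x].
  apply: (measurable_level (c := c) (P := fun n x => c (iterz t n x) = - n)) => // n.
  exact: (@measurable_at _ _ _ _ T n (fun x => c x = - n)).
have mf : measurable_fun setT f.
  move=> _ B mB; rewrite setTI.
  rewrite (_ : f @^-1` B = [set x | (good x /\ exists n, c x = n /\ B (iterz t n x))
      \/ (~ good x /\ B x)]).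
    apply: measurable_or; apply: measurable_and => //.
      apply: measurable_ex => n; apply: measurable_and => //.
      exact: (@measurable_at _ _ _ _ T n B).
    exact: measurable_not.
  apply/seteqP; split => x /=.
    have [h|h] := pselect (good x); first by rewrite fT // => Bx; left; split => //; exists (c x).
    by rewrite fF // => Bx; right.
  by case=> -[h]; [move=> [n [<-]]; rewrite fT | rewrite fF].
have null A : measurable A -> mu A = 0%E -> pushforward mu f A = 0%E.
  move=> mA /(ae_null mu mA) A0; apply/ae_null.
    by rewrite -[X in measurable X]setTI; exact: mf.
  by apply: filterS (ae_orbit T A0) => x; exact.
have nullP A : measurable A -> pushforward mu f A = 0%E <-> mu A = 0%E.
  move=> mA; split; last exact: null.
  have mfA : measurable (f @^-1` A) by rewrite -[X in measurable X]setTI; exact: mf.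
  move=> /(null _ mfA); rewrite /pushforward.
  by rewrite (_ : f @^-1` (f @^-1` A) = A) //; apply/seteqP; split => x /=; rewrite fK.
pose U : Aut mu := \pi_(Aut mu)%qT (NSBij fK fK mf mf nullP).
have Uf : \forall x \ae mu, U x = f x by exact: Aut_piE.
have fU : full_group T U by apply: filterS Uf => x ->; exists (c' x).
exists U; split => //.
  apply: Aut_ext; apply: filterS3 (filterI (ae_AutM U U) (ae_Aut1 mu)) Uf (ae_nsbij U Uf).
  by move=> x [-> ->] e ->; rewrite e fK.
apply: filterS3 (ae_Phi hX hmu hT fU) (ae_orbit T Uf) (ae_orbit T hc) => x hU Ux gx n.
by apply/hU; rewrite Ux (fT _ (gx n)) addrC iterzD.
Qed.

Lemma involution_of_relation (D : int -> X -> Prop) :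
  (forall j, measurable [set x | D j x]) ->
  (\forall x \ae mu, (exists j, D j x) /\ forall j k, D j x -> D k x -> j = k) ->
  (\forall x \ae mu, forall j, D j x -> D (- j) (iterz t j x)) ->
  exists U, [/\ involution U, full_group T U &
    \forall x \ae mu, forall n, D (phi U x n - n) (iterz t n x)].
Proof.
move=> mD totD symD.
have [c [mc Dc]] := measurable_select (0 : int) mD.
have [|U [iU fU hU]] := involution_of_jump mc.
  apply: filterS2 (ae_orbit T totD) symD => x tot sym.
  have [ex un] := tot (c x); apply: un; first exact: Dc.
  by apply: sym; apply: Dc; have [] := tot 0.
exists U; split => //; apply: filterS2 hU (ae_orbit T totD) => x hU' tot n.
by rewrite hU' addrC addKr; apply: Dc; have [] := tot n.
Qed.

Lemma measurable_iter_Phi S i n m : measurable [set x | iter i (phi S x) n = m].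
Proof.
elim: i n m => [|i IH] n m /=; first exact: measurable_prop.
rewrite (_ : [set _ | _] =
    [set x | exists k, iter i (phi S x) n = k /\ phi S x k = m]).
  by apply: measurable_ex => k; apply: measurable_and => //; exact: measurable_Phi.
by apply/seteqP; split => x /=; [exists (iter i (phi S x) n)|case=> k [->]].
Qed.

Lemma reflected_shift (s u : int -> int) (k n j : int) :
  (forall m, u m = s (m + k) - k) -> reflected s n j -> reflected u (n - k) (j - k).
Proof.
move=> us; have it i m : iter i u (m - k) = iter i s m - k.
  by elim: i => //= i ->; rewrite us subrK.
move=> [m [i [mn jm lm]]]; exists (m - k), i; rewrite !it mn jm; split => // q.
by rewrite it lerD2r.
Qed.

Definition finite_cycles (s : int -> int) : Prop :=
  forall n, exists2 p, (0 < p)%N & iter p s n = n.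

(** A permutation with finite cycles is the product of two reflections of each
    of its cycles. The least element of a cycle provides a reflection that is
    equivariant under translations of Z, so that the reflections at the points
    of an orbit come from one element of the full group. *)
Lemma finite_cycles_involutions S : com S ->
  (\forall x \ae mu, finite_cycles (phi S x)) ->
  exists U V, [/\ com U, com V, involution U, involution V & S = (V * U)%g].
Proof.
move=> [fS cS] perS.
have bijS := ae_Phi_bij hX hmu hT fS.
have mD j : measurable [set x | reflected (phi S x) 0 j].
  apply: measurable_ex => m; apply: measurable_ex => i.
  rewrite (_ : [set _ | _] = [set x | iter i (phi S x) m = 0 /\
      (iter i (phi S x) j = m /\ forall k, exists l, iter k (phi S x) m = l /\ m <= l)]).
    apply: measurable_and; first exact: measurable_iter_Phi.
    apply: measurable_and; first exact: measurable_iter_Phi.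
    apply: measurable_all => k; apply: measurable_ex => l.
    apply: measurable_and; first exact: measurable_iter_Phi.
    exact: measurable_prop.
  apply/seteqP; split => x /= [].
    by move=> h1 h2 h3; split => //; split => // k; eexists.
  by move=> h1 [h2 h3]; split => // k; have [l [->]] := h3 k.
have [||U [iU fU hU]] := involution_of_relation mD.
- apply: filterS2 bijS perS => x /bij_inj si sp; split.
    exact: reflected_ex.
  exact: reflected_uniq.
- apply: filterS2 bijS perS => x /bij_inj si sp j /(reflected_sym si sp) h.
  have := reflected_shift (u := phi S (iterz t j x)) (k := j) _ h.
  by rewrite subrr sub0r; apply => m; exact: Phi_shift.
have refl : \forall x \ae mu, forall n, reflected (phi S x) n (phi U x n).
  apply: filterS hU => x hU' n.
  have := reflected_shift (u := phi S x) (k := - n) _ (hU' n).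
  by rewrite !opprK add0r subrK; apply => m; rewrite Phi_shift !subrK.
have cU : com U.
  split => //; apply: filterS3 (filterI bijS perS) refl
    (filterI (ae_Phi_bij hX hmu hT fU) cS) => x [/bij_inj si sp] r [bU sx].
  by apply: (is_symZN_cycles sp sx bU) => n; exact: reflected_cycle si sp _ _ (r n).
have cV : com (S * U)%g by apply: com_full_groupM.
exists U, (S * U)%g; split => //; last by rewrite -mulgA iU mulg1.
apply: (Phi_eq hX hmu hT); [exact: full_groupM cV.1 cV.1|exact: full_group1|].
apply: filterS3 (filterI (ae_PhiM hX hmu hT cV.1 cV.1) (ae_PhiM hX hmu hT fS fU))
  (filterI bijS perS) (filterI refl (ae_Phi1 hX hmu hT)).
move=> x [-> ->] [/bij_inj si sp] [r ->]; apply/funext => n /=.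
exact: (reflected_step si sp (r n) (r _)).
Qed.

Lemma positive_exists (A : set X) (P : X -> Prop) : measurable A ->
  mu A <> 0%E -> (\forall x \ae mu, P x) -> exists x, A x /\ P x.
Proof.
move=> mA A0 hP; apply: contrapT => h; apply: A0; apply/ae_null => //.
by apply: filterS hP => x Px Ax; apply: h; exists x.
Qed.

(** P performs, around the visits to a thin set Z, a finitely supported involution
    tau of the integers that maps to N the common image M0 of N under the Phi S x for x in Z;
    it exists because the index is 0. Then P S preserves the half-lines starting
    at these visits. *)
Lemma index0_finite_cycles S : com S -> com_index T S = 0 ->
  exists P, [/\ com P, involution P & \forall x \ae mu, finite_cycles (phi (P * S)%g x)].
Proof.
move=> cS iS; have [fS sS] := cS.
have [M0 [cM0 pM0]] := com_positive_image cS.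
have mM0 : measurable [set x | phi S x @` Nset = M0].
  by apply: measurable_image_eq; exact: measurable_Phi.
have [|tau [tauK [K tauS] tauM]] := swap_to_Nset cM0.
  have [x [/= xM [sx ix]]] :=
    positive_exists mM0 pM0 (filterI sS (ae_com_index hT cS)).
  move: ix; rewrite iS -[phi S x]/(SymZN sx : int -> int) -symZN_index_sum.
  by rewrite /symZN_index /= xM => /eqP; rewrite subr_eq0 => /eqP[].
have tauB i : (`|i| <= K)%N -> (`|tau i| <= K)%N.
  move=> iK; rewrite leqNgt; apply/negP => h.
  by have := tauS _ h; rewrite tauK => e; move: h; rewrite -e ltnNge iK.
pose Y0 := [set x | phi S x @` Nset = M0 /\ forall n, n != 0 -> iterz t n x <> x].
have mY0 : measurable Y0.
  apply: measurable_and => //; apply: measurable_all => n.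
  apply: measurable_imp; first exact: measurable_prop.
  apply: measurable_not; apply: (measurable_eq_fun hX (f := iterz t n) (g := id)).
    exact: measurable_iterz.
  exact: measurable_id.
have Y00 : mu Y0 <> 0%E.
  move=> /(ae_null mu mY0) h; apply: pM0; apply/ae_null => //.
  by apply: filterS2 h (ae_aperiodic hX hmu hT) => x nY ap xM; apply: nY.
(* Distinct visits to Z are more than 2 K apart, so that the windows of radius K
   around them, in which tau is performed, do not overlap. *)
pose J : seq int := [seq Posz i.+1 | i <- iota 0 K.*2] ++ [seq Negz i | i <- iota 0 K.*2].
have inJ j : j != 0 -> (`|j| <= K.*2)%N -> j \in J.
  move=> j0 jK; rewrite mem_cat; apply/orP.
  case: j j0 jK => [[|j]|j] // _ jK; [left|right]; apply: map_f;
    rewrite mem_iota /=; lia.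
have nJ j : j \in J -> j != 0.
  by rewrite mem_cat => /orP[] /mapP[i _ ->].
have [|Z [mZ Z0 ZY hZ]] := disjoint_translates hX (t := t) (J := J) mY0 Y00.
  by move=> x j [_ ap] /nJ; exact: ap.
have sepZ x i k : Z (iterz t i x) -> Z (iterz t k x) -> i != k -> (K.*2 < `|i - k|)%N.
  move=> Zi Zk ik; rewrite ltnNge; apply/negP => /inJ h.
  have := hZ _ _ (h _) Zk; rewrite subr_eq0 => /(_ ik); apply.
  by rewrite -iterzD subrK.
pose near_visit i x := (`|i| <= K)%N /\ Z (iterz t (- i) x).
pose D (j : int) x := (exists i, near_visit i x /\ j = tau i - i) \/
  (j = 0 /\ ~ exists i, near_visit i x).
have mnear i : measurable [set x | near_visit i x].
  apply: measurable_and; first exact: measurable_prop.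
  exact: (@measurable_at _ _ _ _ T (- i) Z).
have mD j : measurable [set x | D j x].
  apply: measurable_or.
    apply: measurable_ex => i; apply: measurable_and => //; exact: measurable_prop.
  apply: measurable_and; first exact: measurable_prop.
  by apply: measurable_not; exact: measurable_ex.
have [||P [iP fP hP]] := involution_of_relation mD.
- apply: filterE => x; split.
    have [[i hi]|h] := pselect (exists i, near_visit i x); last by exists 0; right.
    by exists (tau i - i); left; exists i.
  move=> j k [[i [ni ->]]|[-> ni]] [[i' [ni' ->]]|[-> ni']] //.
  + suff -> : i = i' by [].
    apply/eqP/negPn/negP => ii; have [[iK Zi] [iK' Zi']] := (ni, ni').
    have : - i != - i' by rewrite eqr_opp.
    by move=> /(sepZ _ _ _ Zi Zi'); lia.
  + by case: ni'; exists i.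
  + by case: ni; exists i'.
- apply: filterE => x j [[i [[iK Zi] ->]]|[-> ni]]; last by right; rewrite oppr0.
  left; exists (tau i); split; last by rewrite tauK opprB.
  split; first exact: tauB.
  by rewrite -iterzD addrA addNr sub0r.
have piP : \forall x \ae mu, forall n,
    (exists i, [/\ (`|i| <= K)%N, Z (iterz t (n - i) x) & phi P x n = n - i + tau i]) \/
    (phi P x n = n /\ forall i, (`|i| <= K)%N -> ~ Z (iterz t (n - i) x)).
  apply: filterS hP => x hP n; case: (hP n) => [[i [[iK Zi] e]]|[e nZ]].
    left; exists i; split => //; first by rewrite addrC iterzD.
    by lia.
  right; split; first by lia.
  move=> i iK Zi; apply: nZ; exists i; split => //.
  by rewrite -iterzD addrC.
have cP : com P.
  split => //; apply: filterS2 piP (ae_Phi_bij hX hmu hT fP) => x hx bx.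
  apply: (is_symZN_bounded (K := K.*2) bx) => n.
  case: (hx n) => [[i [iK _ ->]]|[-> _]]; last by rewrite subrr.
  by have := tauB _ iK; lia.
exists P; split => //; set S' := (P * S)%g.
have cS' : com S' by exact: com_full_groupM.
(* At a visit, P maps M0 to N: around other visits it preserves both sides. *)
have half : \forall x \ae mu, Z x -> forall n, 0 <= phi S' x n <-> 0 <= n.
  apply: filterS3 piP (ae_PhiM hX hmu hT fP fS) (ae_Phi_bij hX hmu hT fS).
  move=> x hpi eM /bij_inj bx Zx n; have [xM _] := ZY _ Zx.
  rewrite eM /=; have pM k : 0 <= phi P x k <-> M0 k.
    have Z0x : Z (iterz t 0 x) by [].
    case: (hpi k) => [[i [iK Zi ->]]|[-> nZ]].
      have [k0|k0] := eqVneq (k - i) 0.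
        rewrite k0 add0r; have -> : i = k by lia.
        by rewrite tauM.
      have := sepZ _ _ _ Zi Z0x k0; have := tauB _ iK => tK sep.
      by rewrite tauM (tauS k); [lia|lia].
    rewrite tauM tauS //; rewrite ltnNge; apply/negP => /nZ; apply.
    by rewrite subrr.
  rewrite pM -xM; split => [[m Nm /bx <-]//|n0]; by exists n.
apply: filterS3 (ae_orbit T half) (ae_recurrent hmu hT mZ Z0)
  (ae_Phi_bij hX hmu hT cS'.1) => x hx rec /bij_inj bx n.
apply: finite_orbit_cycle => //.
have [_ [a an Za]] := rec n; have [[b nb Zb] _] := rec (n + 1).
have cut k : Z (iterz t k x) -> forall m, k <= phi S' x m <-> k <= m.
  by move=> /hx h m; have := h (m - k); rewrite Phi_shift subrK !subr_ge0.
have stay i : a <= iter i (phi S' x) n < b.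
  elim: i => [|i /andP[ai ib]] /=; first by lia.
  apply/andP; split; first exact/(cut _ Za).
  rewrite ltNge; apply/negP => /(cut _ Zb); lia.
apply: (@sub_finite_set _ _ ((fun i : nat => a + i%:Z) @` `I_(`|b - a|))).
  move=> _ [i _ <-]; exists (absz (iter i (phi S' x) n - a)); have := stay i => /=; lia.
by apply: finite_image; exact: finite_II.
Qed.

End realization.

(** * Approximation of involutions by commutators *)

(** Here w matches with one another some of the integers that u moves to the
    right, and v is the part of u over the left element of every matched pair.
    Conjugation by w' = w u w u, which performs w also on the images by u, carries
    v to the part of u over the right elements. So the commutator of v and w' is
    the part of u over all matched integers. *)
Lemma commutator_of_matching (u w v : int -> int) :
  involutive u -> involutive w -> (forall n, w n <> n -> n < u n) ->
  (forall n, v n = if (n < w n) || (u n < w (u n)) then u n else n) ->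
  forall n, v (u (w (u (w (v (w (u (w (u n))))))))) =
    if (w n != n) || (w (u n) != u n) then u n else n.
Proof.
move=> uK wK wa vE.
have wna n : u n <= n -> w n = n.
  by move=> h; apply: contrapT => /wa; rewrite ltNge h.
have wu n : w n <> n -> w (u n) = u n.
  by move=> /wa h; apply: wna; rewrite uK ltW.
have wwa n : w n <> n -> w (u (w n)) = u (w n).
  by move=> h; apply: wu; rewrite wK => e; apply: h.
have vu n : v (u n) = if (u n < w (u n)) || (n < w n) then n else u n.
  by rewrite vE uK.
move=> n; have [wn|/eqP wn] := eqVneq (w n) n; last first.
  have [wun wwn] := (wu n wn, wwa n wn).
  rewrite /= wun uK (vE (w n)) wwn wK ltxx orbF.
  have [gt|lt|e] := ltrgtP (w n) n; last by case: wn.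
    by rewrite wwn uK wK vu wun ltxx /= ltNge (ltW gt).
  by rewrite wK wun uK vE lt.
have [wun|/eqP wun] := eqVneq (w (u n)) (u n).
  have vn : v n = n by rewrite vE wn wun !ltxx.
  by rewrite /= wun uK wn vn wn wun uK.
rewrite /=; set p := u n in wun *; have nE : u p = n by rewrite uK.
have wwp := wwa p wun; rewrite wwp (vu (w p)) wwp wK ltxx /=.
have [gt|lt|e] := ltrgtP (w p) p; last by case: wun.
  by rewrite wK nE wn vE nE wn ltxx orbF ltNge (ltW gt).
by rewrite wwp uK wK nE vE -/p lt orbT.
Qed.

Section approximation.
Context (R : realType) d (X : measurableType d) (mu : probability X R).
Variable T : Aut mu.
Hypotheses (hX : standard_borel R X) (hmu : atomless mu) (hT : ergodic T).
Local Notation t := (Aut_repr T).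
Local Notation phi := (Phi_fun T).
Local Notation com := (com_full_group T).
Implicit Types S U V W : Aut mu.

(** Go through all pairs of a positive jump and a set E of a separating sequence,
    and at each stage match, among the points of A not matched yet, the points
    of E with their image under the jump when it is outside of E. Two points of
    an orbit cannot both remain unmatched, so that the unmatched points meet
    every orbit at most once. *)
Lemma matching (A : set X) : measurable A -> exists m : X -> int,
  [/\ forall n, measurable [set x | m x = n],
      forall x, m (iterz t (m x) x) = - m x,
      forall x, m x <> 0 -> A x &
      \forall x \ae mu, A x -> m x <> 0].
Proof.
move=> mA; have [E [mE sE]] := separating_sequence hX.
pose code (k : nat) : nat * nat := odflt (0%N, 0%N) (choice.unpickle k).
pose jump k : int := ((code k).1.+1)%:Z.
pose next (rest : set X) k := [set x | [/\ rest x, rest (iterz t (jump k) x),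
  E (code k).2 x & ~ E (code k).2 (iterz t (jump k) x)]].
pose rest := fix rest k : set X := if k is k'.+1 then
  [set x | [/\ rest k' x, ~ next (rest k') k' x &
    ~ next (rest k') k' (iterz t (- jump k') x)]] else A.
pose B k := next (rest k) k.
have restS k : rest k.+1 = [set x | [/\ rest k x, ~ B k x & ~ B k (iterz t (- jump k) x)]].
  by [].
have mat n (P : set X) : measurable P -> measurable [set x | P (iterz t n x)].
  by move=> mP; exact: (@measurable_at _ _ _ _ T n P).
have mnext P k : measurable P -> measurable (next P k).
  move=> mP; rewrite (_ : next P k = [set x | P x /\ (P (iterz t (jump k) x) /\
      (E (code k).2 x /\ ~ E (code k).2 (iterz t (jump k) x)))]).
    do !apply: measurable_and; [exact: mP|exact: mat|exact: mE|].
    by apply: measurable_not; exact: mat.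
  by apply/seteqP; split => x /=; [case|case=> ? [? []]].
have mrest k : measurable (rest k).
  elim: k => // k IH; rewrite restS (_ : [set x | _] = [set x | rest k x /\
      (~ B k x /\ ~ B k (iterz t (- jump k) x))]).
    have mB := mnext _ k IH.
    by do !apply: measurable_and => //; apply: measurable_not => //; exact: mat.
  by apply/seteqP; split => x /=; [case|case=> ? []].
have mB k : measurable (B k) by exact: mnext.
have rest_sub k l : (k <= l)%N -> rest l `<=` rest k.
  move=> kl; rewrite -(subnKC kl); elim: (l - k)%N => [|i IH]; first by rewrite addn0.
  by rewrite addnS restS => x [/IH].
pose C k x := B k x \/ B k (iterz t (- jump k) x).
have C_rest k x : C k x -> rest k x.
  by case=> -[//]; rewrite -iterzD subrr.
have C_next k x : C k x -> ~ rest k.+1 x.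
  by rewrite restS => -[h [] //|h [_ _]].
have C_uniq k l x : C k x -> C l x -> k = l.
  move=> Ck Cl; case: (ltngtP k l) => // kl; exfalso.
    exact: (C_next k x Ck (rest_sub _ _ kl x (C_rest _ _ Cl))).
  exact: (C_next l x Cl (rest_sub _ _ kl x (C_rest _ _ Ck))).
have BB k x : B k x -> ~ B k (iterz t (- jump k) x).
  by move=> [_ _ Ex _] [_ _ _]; rewrite -iterzD subrr.
pose D (j : int) x := (exists k, B k x /\ j = jump k) \/
  ((exists k, B k (iterz t (- jump k) x) /\ j = - jump k) \/
   (j = 0 /\ forall k, ~ C k x)).
have D_uniq x i j : D i x -> D j x -> i = j.
  move=> [[k [Bk ->]]|[[k [Bk ->]]|[-> nC]]] [[l [Bl ->]]|[[l [Bl ->]]|[-> nC']]] //.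
  - by rewrite (C_uniq k l x) //; left.
  - have kl : k = l by apply: (C_uniq _ _ x); [left|right].
    by case: (BB k x) => //; rewrite kl.
  - by case: (nC' k); left.
  - have kl : k = l by apply: (C_uniq _ _ x); [right|left].
    by case: (BB k x) => //; rewrite kl.
  - by rewrite (C_uniq k l x) //; right.
  - by case: (nC' k); right.
  - by case: (nC l); left.
  - by case: (nC l); right.
have D_sym x j : D j x -> D (- j) (iterz t j x).
  move=> [[k [Bk ->]]|[[k [Bk ->]]|[-> nC]]].
  - by right; left; exists k; rewrite iterzK.
  - by left; exists k; rewrite opprK.
  - by right; right; rewrite oppr0.
have mD j : measurable [set x | D j x].
  apply: measurable_or.
    apply: measurable_ex => k; apply: measurable_and; [exact: mB|exact: measurable_prop].
  apply: measurable_or.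
    apply: measurable_ex => k; apply: measurable_and; last exact: measurable_prop.
    exact: mat.
  apply: measurable_and; first exact: measurable_prop.
  apply: measurable_all => k; apply: measurable_not; apply: measurable_or; [exact: mB|].
  exact: (mat _ (B k)).
have [m [mm Dm]] := measurable_select (0 : int) mD.
have {}Dm x : D (m x) x.
  suff h : exists j, D j x by exact: (Dm x h).
  have [[k [Bk|Bk]]|nC] := pselect (exists k, C k x).
  - by exists (jump k); left; exists k.
  - by exists (- jump k); right; left; exists k.
  - by exists 0; right; right; split => // k Ck; apply: nC; exists k.
exists m; split => //.
- by move=> x; apply: D_uniq (Dm _) (D_sym _ _ (Dm x)).
- move=> x m0; have [[k [Bk _]]|[[k [Bk _]]|[//]]] := Dm x.
    by apply: (rest_sub 0%N k) => //; apply: C_rest; left.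
  by apply: (rest_sub 0%N k) => //; apply: C_rest; right.
have mZ : measurable [set x | A x /\ m x = 0] by exact: measurable_and.
suff /(ae_null mu mZ) : mu [set x | A x /\ m x = 0] = 0%E.
  by apply: filterS => x h Ax m0; apply: h.
have stays x : A x -> m x = 0 -> forall k, rest k x.
  move=> Ax m0; have nC : forall k, ~ C k x.
    have := Dm x; rewrite m0 => -[[k [_]]|[[k [_]]|[_ //]]]; rewrite /jump; lia.
  elim=> // k IH; rewrite restS; split => // h; apply: (nC k); [by left|by right].
have nopair x (n : nat) : (forall k, rest k x) -> (forall k, rest k (iterz t n.+1 x)) ->
    iterz t n.+1 x = x.
  move=> rx ry; apply: contrapT => /nesym/sE[e [Ex Ey]].
  pose k : nat := choice.pickle (n, e).
  have ck : code k = (n, e) by rewrite /code choice.pickleK.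
  have Bk : B k x.
    split; [exact: rx| |by rewrite ck|by rewrite /jump ck].
    by rewrite /jump ck; exact: ry.
  by have := rx k.+1; rewrite restS => -[].
apply: (null_partial_section hmu hT) => // x n [Ax mx] [Ay my].
have [rx ry] := (stays _ Ax mx, stays _ Ay my).
case: n Ay my ry => [[|n]|n] // Ay my ry; first exact: nopair.
have e : x = iterz t n.+1 (iterz t (Negz n) x) by rewrite NegzE -iterzD subrr.
rewrite [RHS]e; apply/esym; apply: nopair => //.
by move=> k; rewrite -e.
Qed.

(** This is almost everywhere convergence in Sym(Z, N), the topology of which is
    that of pointwise convergence on the discrete set [CommN]. *)
Definition ae_tends (F : nat -> Aut mu) S : Prop :=
  \forall x \ae mu, forall M, CommN M -> exists k0, forall k, (k0 <= k)%N ->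
    phi (F k) x @` M = phi S x @` M.

Lemma com_commutator U V : com U -> com V -> derived_subgroup com [~ U, V]%g.
Proof. by move=> cU cV H [_]; apply; exists U => //; exists V. Qed.

(** Match the points that U moves to the right with one another, ignoring
    matchings by long jumps so as to stay in the commensurating full group. The
    part of U over matched points is a commutator, and it exhausts U. *)
Lemma involution_limit U : com U -> involution U ->
  exists F, (forall k, derived_subgroup com (F k)) /\ ae_tends F U.
Proof.
move=> cU iU; have [fU sU] := cU.
pose A := [set x | 0 < phi U x 0].
have mA : measurable A.
  apply: (measurable_level (c := fun x => phi U x 0) (P := fun n _ => 0 < n)) => n.
    exact: measurable_Phi.
  exact: measurable_prop.
have [m [mm mK mAs mex]] := matching mA.
pose mt (k : nat) x : int := if (`|m x| <= k)%N then m x else 0.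
have mtK k x : mt k (iterz t (mt k x) x) = - mt k x.
  have [h|/negbTE h] := boolP (`|m x| <= k)%N.
    have -> : mt k x = m x by rewrite /mt h.
    by rewrite /mt mK abszN h.
  have e : mt k x = 0 by rewrite /mt h.
  by rewrite e iterz0 e oppr0.
have mt0 k y : m y = 0 -> mt k y = 0.
  by move=> h; rewrite /mt h; case: (_ <= _)%N.
have mmt k n : measurable [set x | mt k x = n].
  apply: (measurable_level (c := m)
    (P := fun i _ => (if (`|i| <= k)%N then i else 0) = n)) => // i.
  exact: measurable_prop.
have UK : \forall x \ae mu, involutive (phi U x).
  have := ae_PhiM hX hmu hT fU fU; rewrite iU.
  apply: filterS2 (ae_Phi1 hX hmu hT) => x -> e n.
  by rewrite -[LHS]/((phi U x \o phi U x) n) -e.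
(* cV is the jump of U over the left elements of the pairs matched by mt. *)
pose half k x := 0 < mt k x \/ 0 < mt k (iterz t (phi U x 0) x).
pose cV k x : int := if `[< half k x >] then phi U x 0 else 0.
have mhalf k : measurable [set x | half k x].
  apply: measurable_or.
    apply: (measurable_level (c := mt k) (P := fun n _ => 0 < n)) => // n.
    exact: measurable_prop.
  apply: (measurable_level (c := fun x => phi U x 0)
    (P := fun n x => 0 < mt k (iterz t n x))) => n; first exact: measurable_Phi.
  apply: (@measurable_at _ _ _ _ T n (fun x => 0 < mt k x)).
  apply: (measurable_level (c := mt k) (P := fun n _ => 0 < n)) => // i.
  exact: measurable_prop.
have mcV k n : measurable [set x | cV k x = n].
  rewrite (_ : [set _ | _] = [set x | (half k x /\ phi U x 0 = n) \/
      (~ half k x /\ 0 = n)]).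
    apply: measurable_or; apply: measurable_and => //.
    - exact: measurable_Phi.
    - exact: measurable_not.
    - exact: measurable_prop.
  apply/seteqP; split => x /=; rewrite /cV.
    by case: asboolP => h; [left|right].
  by case: asboolP => h [[]|[]].
have /choice[W hW] : forall k, exists W : Aut mu, [/\ involution W, full_group T W &
    \forall x \ae mu, forall n, phi W x n = n + mt k (iterz t n x)].
  by move=> k; apply: involution_of_jump => //; exact: filterE.
have /choice[V hV] : forall k, exists V : Aut mu, [/\ involution V, full_group T V &
    \forall x \ae mu, forall n, phi V x n = n + cV k (iterz t n x)].
  move=> k; apply: involution_of_jump => //; apply: filterS UK => x uK.
  have [h|h] := pselect (half k x); last first.
    have e : cV k x = 0 by rewrite /cV (asboolF h).
    by rewrite e iterz0 e oppr0.
  have -> : cV k x = phi U x 0 by rewrite /cV (asboolT h).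
  have e : phi U (iterz t (phi U x 0) x) 0 = - phi U x 0.
    by rewrite Phi_shift add0r uK sub0r.
  have h' : half k (iterz t (phi U x 0) x).
    by case: h; rewrite /half e iterzK; [right|left].
  by rewrite /cV (asboolT h') e.
have comW k : com (W k).
  have [_ fW pW] := hW k; split => //.
  apply: filterS2 pW (ae_Phi_bij hX hmu hT fW) => x pW bW.
  apply: (is_symZN_bounded (K := k) bW) => n.
  by rewrite pW addrC addKr /mt; case: ifP.
have comV k : com (V k).
  have [_ fV pV] := hV k; split => //.
  apply: filterS3 pV (ae_Phi_bij hX hmu hT fV) sU => x pV bV sx.
  apply: (is_symZN_sub sx bV) => n; rewrite pV /cV; case: asboolP => h.
    by right; rewrite Phi_shift add0r addrC subrK.
  by left; rewrite addr0.
have invV S : involution S -> (S^-1)%g = S.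
  by move=> iS; apply: (mulgI S); rewrite mulgV iS.
pose W' k := (W k * U * W k * U)%g.
have comW' k : com (W' k) by do !apply: com_full_groupM.
exists (fun k => [~ V k, W' k]%g); split; first by move=> k; exact: com_commutator.
have FE k : [~ V k, W' k]%g = (V k * (U * (W k * (U * (W k *
    (V k * (W k * (U * (W k * U)))))))))%g.
  have [iW _ _] := hW k; have [iV _ _] := hV k.
  by rewrite commgEl conjgE /W' !invgM !invV // !mulgA.
have allPhi : \forall x \ae mu, forall k,
    [/\ forall n, phi (W k) x n = n + mt k (iterz t n x),
        forall n, phi (V k) x n = n + cV k (iterz t n x) &
        phi [~ V k, W' k]%g x = phi (V k) x \o (phi U x \o (phi (W k) x \o (phi U x \o
          (phi (W k) x \o (phi (V k) x \o (phi (W k) x \o (phi U x \o (phi (W k) x \o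
            phi U x))))))))].
  apply: ae_all => k; have [_ fW pW] := hW k; have [_ fV pV] := hV k.
  have M S S' : full_group T S -> full_group T S' -> full_group T (S * S')%g.
    exact: full_groupM.
  rewrite FE; have f1 := M _ _ fW fU; have f2 := M _ _ fU f1.
  have f3 := M _ _ fW f2; have f4 := M _ _ fV f3; have f5 := M _ _ fW f4.
  have f6 := M _ _ fU f5; have f7 := M _ _ fW f6; have f8 := M _ _ fU f7.
  have P S S' := @ae_PhiM _ _ _ _ T hX hmu hT S S'.
  apply: filterS3 pW pV (filterI (P _ _ fW fU) (filterI (P _ _ fU f1)
    (filterI (P _ _ fW f2) (filterI (P _ _ fV f3) (filterI (P _ _ fW f4)
    (filterI (P _ _ fU f5) (filterI (P _ _ fW f6) (filterI (P _ _ fU f7)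
    (P _ _ fV f8))))))))).
  move=> x hw hv [e1 [e2 [e3 [e4 [e5 [e6 [e7 [e8 e9]]]]]]]].
  by split => //; rewrite e9 e8 e7 e6 e5 e4 e3 e2 e1.
have mexo := ae_orbit T mex.
apply: filterS3 (filterI allPhi UK) mexo sU => x [hP uK] hm sx M cM.
set u := phi U x in hP uK sx *.
have phiE n : phi U (iterz t n x) 0 = u n - n by rewrite Phi_shift add0r.
have FkE k n : phi [~ V k, W' k]%g x n =
    if (mt k (iterz t n x) != 0) || (mt k (iterz t (u n) x) != 0) then u n else n.
  have [pW pV ->] := hP k; rewrite /= -/u.
  rewrite (@commutator_of_matching u (phi (W k) x) (phi (V k) x)) //.
  - have addE (i j : int) : (i + j != i) = (j != 0) by lia.
    by rewrite !pW !addE.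
  - by move=> i; rewrite !pW (addrC i) iterzD mtK addrAC subrr add0r.
  - move=> i; rewrite pW => wi; rewrite -subr_gt0 -phiE; apply: mAs.
    by move=> m0; apply: wi; rewrite (mt0 _ _ m0) addr0.
  move=> i; rewrite pV !pW !ltrDl /cV phiE.
  have -> : `[< half k (iterz t i x) >] = (0 < mt k (iterz t i x)) || (0 < mt k (iterz t (u i) x)).
    rewrite /half phiE -iterzD subrK.
    by apply/asboolP/orP.
  by case: ifP => _; [rewrite addrC subrK|rewrite addr0].
have FK k : involutive (phi [~ V k, W' k]%g x).
  move=> n; rewrite [X in phi _ _ X]FkE; case: ifP => h; rewrite FkE.
    by rewrite uK orbC h.
  by rewrite h.
have imE (f : int -> int) : involutive f -> f @` M = f @^-1` M.
  move=> fK; apply/seteqP; split => n /=; first by move=> [i Mi <-]; rewrite fK.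
  by exists (f n).
(* An integer that crosses M under u, or else its image, is moved to the right by u,
   hence is matched as soon as k bounds its jump. *)
have /finite_seqP[r rE] := finite_crossing sx cM.
exists (\sum_(n <- r) (`|m (iterz t n x)| + `|m (iterz t (u n) x)|))%N => k hk.
rewrite !imE //; apply/seteqP.
suff same n : M (phi [~ V k, W' k]%g x n) <-> M (u n) by split => n /=; apply same.
rewrite FkE; case: ifP => // /negbT; rewrite negb_or !negbK => /andP[/eqP m1 /eqP m2].
apply: contrapT => h; have nr : crossing M u n by [].
have nin : n \in r by rewrite -/([set` r] n) -rE.
have un : u n <> n by move=> e; apply: h; rewrite e.
have le : (`|m (iterz t n x)| + `|m (iterz t (u n) x)| <= k)%N.
  by apply: leq_trans hk; rewrite (big_rem n) //= leq_addr.
have le1 := leq_trans (leq_addr _ _) le; have le2 := leq_trans (leq_addl _ _) le.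
rewrite /mt le1 in m1; rewrite /mt le2 in m2.
case: (ltrgtP n (u n)) => nu; last by case: un.
  by apply: (hm n) m1; rewrite /A /= phiE subr_gt0.
by apply: (hm (u n)) m2; rewrite /A /= phiE uK subr_gt0.
Qed.

End approximation.

(** * Closures and the kernel of the index *)

Section generated_subgroups.
Variable G : groupType.
Implicit Types A K : set G.

Lemma group_closedP K : group_closed (mem K) <->
  K 1%g /\ forall x y, K x -> K y -> K (x * y^-1)%g.
Proof.
split=> [[K1 KV]|[K1 KV]]; split.
- by move: K1; rewrite inE.
- by move=> x y Kx Ky; have := KV x y (mem_set Kx) (mem_set Ky); rewrite inE.
- exact: mem_set.
- by move=> x y /set_mem Kx /set_mem Ky; apply: mem_set; exact: KV.
Qed.

Lemma subgroup_generated_closed A : group_closed (mem (subgroup_generated A)).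
Proof.
apply/group_closedP; split; first by move=> H [/group_closedP[]].
by move=> x y Ax Ay H HA; have /group_closedP[_] := HA.1; apply; [exact: Ax|exact: Ay].
Qed.

Lemma sub_subgroup_generated A : A `<=` subgroup_generated A.
Proof. by move=> x Ax H [_]; exact. Qed.

Lemma subgroup_generated_min A K : group_closed (mem K) -> A `<=` K ->
  subgroup_generated A `<=` K.
Proof. by move=> cK AK x; apply; split. Qed.

Lemma subgroup_generatedM A x y : subgroup_generated A x ->
  subgroup_generated A y -> subgroup_generated A (x * y)%g.
Proof.
have /group_closedP[A1 AV] := subgroup_generated_closed A.
by move=> Ax Ay; rewrite -[y]invgK -[(y^-1)%g]mul1g; apply: (AV) => //; exact: AV.
Qed.

End generated_subgroups.

Section index_kernel.
Context (R : realType) d (X : measurableType d) (mu : probability X R).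
Variable T : Aut mu.
Hypotheses (hX : standard_borel R X) (hmu : atomless mu) (hT : ergodic T).
Local Notation t := (Aut_repr T).
Local Notation phi := (Phi_fun T).
Local Notation com := (com_full_group T).
Implicit Types S U V W : Aut mu.

Let ker_index : set (Aut mu) := [set S | com S /\ com_index T S = 0].

Lemma ker_index_closed : group_closed (mem ker_index).
Proof.
apply/group_closedP; split.
  split; [exact: com_full_group1|exact: com_index1].
move=> S U [cS iS] [cU iU]; have cV := com_full_groupV hX hmu hT cU.
split; first exact: com_full_groupM.
by rewrite com_indexM // com_indexV // iS iU subrr.
Qed.

Lemma ker_index_normal : normal_subgroup ker_index com.
Proof.
split; [by move=> S []|exact: ker_index_closed|].
move=> S U cS [cU iU]; have cV := com_full_groupV hX hmu hT cS.
have cUS := com_full_groupM hX hmu hT cU cS.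
rewrite conjgE; split; first exact: com_full_groupM.
by rewrite !com_indexM // com_indexV // iU add0r addNr.
Qed.

Lemma derived_sub_ker_index : derived_subgroup com `<=` ker_index.
Proof.
apply: subgroup_generated_min; first exact: ker_index_closed.
move=> _ [S cS [U cU <-]]; have [_ _ nor] := ker_index_normal.
have [cS' cU'] := (com_full_groupV hX hmu hT cS, com_full_groupV hX hmu hT cU).
have cUS := com_full_groupM hX hmu hT cS cU.
rewrite commgEl conjgE; split; first by do !apply: com_full_groupM.
rewrite !com_indexM ?com_indexV //; first lia.
by apply: com_full_groupM.
Qed.

(** The index only depends on the image of N, hence is locally constant. *)
Lemma closure_sub_ker_index A : A `<=` ker_index -> com_closure T A `<=` ker_index.
Proof.
move=> AK _ [S clS <-]; have cS : com (val S) by exact: set_mem (valP S).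
split => //.
pose V := symZN_stab [set Nset].
have eV : entourage V.
  exists [set Nset] => //; split; first exact: finite_set1.
  by move=> _ ->; exact: CommN_Nset.
pose B := [set U : com_space T | L0_close V 1 (Phi T (val S), Phi T (val U))].
have nB : nbhs (S : com_space T) B.
  have c : {for (S : com_space T), continuous
      ((fun U : com => Phi T (val U)) : com_space T -> L0 mu symZN)}.
    exact: initial_continuous.
  apply: (c [set g | L0_close V 1 (Phi T (val S), g)]).
  rewrite -nbhs_entourageE; exists (L0_close V 1); last first.
    by move=> g; rewrite /xsection /= inE.
  by exists (V, 1) => //=; split.
have [U [/AK[cU iU] close]] := clS _ nB.
have good : \forall x \ae mu, [/\ zindex (phi (val S) x) = com_index T (val S),
    zindex (phi (val U) x) = com_index T (val U),
    (Phi T (val S) x : symZN) = phi (val S) x :> (int -> int) &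
    (Phi T (val U) x : symZN) = phi (val U) x :> (int -> int)].
  apply: filterS2 (filterI (ae_com_index hT cS) (ae_com_index hT cU))
    (filterI (ae_Phi_class cS) (ae_Phi_class cU)) => x [h1 h2] [h3 h4].
  by split.
have [x [[hS hU pS pU] xV]] : exists x, [/\ zindex (phi (val S) x) = com_index T (val S),
    zindex (phi (val U) x) = com_index T (val U),
    (Phi T (val S) x : symZN) = phi (val S) x :> (int -> int) &
    (Phi T (val U) x : symZN) = phi (val U) x :> (int -> int)] /\
    V (Phi T (val S) x, Phi T (val U) x).
  (* Otherwise the two maps would be far apart on a conull set. *)
  apply: contrapT => none; have [N [mN N0 sN]] := good.
  move: close; rewrite /B /L0_close /= ltNge => /negP; apply.
  rewrite (_ : 1%:E = mu (~` N)); last first.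
    by rewrite probability_setC // N0 sube0.
  rewrite -(measurable_mu_extE mu (measurableC mN)).
  apply: le_outer_measure => x nN /= Vx; apply: none; exists x; split => //.
  by apply: contrapT => h; apply: nN; exact: sN.
rewrite -iU -hU -hS -pS -pU; apply: zindex_image; [exact: symZNP|exact: symZNP|].
exact: xV.
Qed.

(** This is continuity of mu along the sets of points that are bad at some later
    stage. *)
Lemma eventually_small (bad : nat -> set X) (e : R) : (forall k, measurable (bad k)) ->
  (\forall x \ae mu, exists k0, forall k, (k0 <= k)%N -> ~ bad k x) -> 0 < e ->
  exists k, (mu (bad k) < e%:E)%E.
Proof.
move=> mbad ev e0; pose F k := [set x | exists i, (k <= i)%N /\ bad i x].
have mF k : measurable (F k).
  apply: measurable_ex => i; apply: measurable_and; first exact: measurable_prop.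
  exact: mbad.
have mI : measurable (\bigcap_k F k) by exact: bigcapT_measurable.
have I0 : mu (\bigcap_k F k) = 0%E.
  apply/ae_null => //; apply: filterS ev => x [k0 h] /(_ k0 I)[i [ki bi]].
  exact: (h i).
have cvF : mu \o F @ \oo --> mu (\bigcap_k F k).
  apply: nonincreasing_cvg_mu => //.
    by apply: le_lt_trans (probability_le1 _ _) _ => //; rewrite ltry.
  by move=> i j ij; apply/subsetPset => x [k [jk bk]]; exists k; split => //; exact: leq_trans jk.
have [|k _ hk] := cvF [set y | (y < e%:E)%E].
  by rewrite I0; apply: open_nbhs_nbhs; split; [exact: open_ereal_lt_ereal|rewrite /= lte_fin].
exists k; apply: le_lt_trans (hk k (leqnn k)).
by apply: le_measure; rewrite ?inE // => x bx; exists k.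
Qed.

(** Almost everywhere convergence implies convergence in measure. *)
Lemma ae_tends_closure (A : set (Aut mu)) (F : nat -> Aut mu) S :
  (forall k, A (F k)) -> A `<=` com -> com S -> ae_tends T F S -> com_closure T A S.
Proof.
move=> AF Ac cS FS; exists (exist _ S (mem_set cS)) => //.
move=> B [_ [[Q oQ <-] QS] QB].
have nQ : nbhs (Phi T S) Q by exact: open_nbhs_nbhs.
move: nQ; rewrite -nbhs_entourageE => -[E [[V e] /= [[P [fP PC] PV] e0] VE] EQ].
pose bad k := [set x | exists a, P (commN a) /\ phi (F k) x @` commN a <> phi S x @` commN a].
have mbad k : measurable (bad k).
  apply: measurable_ex => a; apply: measurable_and; first exact: measurable_prop.
  apply: measurable_not; apply: measurable_images_eq => n m; exact: measurable_Phi.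
have ev : \forall x \ae mu, exists k0, forall k, (k0 <= k)%N -> ~ bad k x.
  apply: filterS FS => x hx.
  have /choice[k0 hk0] : forall M, exists k0, P M -> forall k, (k0 <= k)%N ->
      phi (F k) x @` M = phi S x @` M.
    move=> M; have [PM|nP] := pselect (P M); last by exists 0%N.
    by have [k0 h] := hx M (PC _ PM); exists k0.
  have /finite_seqP[r rP] : finite_set (k0 @` P) by exact: finite_image.
  exists (\max_(i <- r) i)%N => k rk [a [Pa]]; apply; apply: hk0 => //.
  have kr : k0 (commN a) \in r by rewrite -/([set` r] _) -rP; exists (commN a).
  by apply: leq_trans rk; exact: (leq_bigmax_seq (F := id)).
have [k hk] := eventually_small mbad ev e0.
exists (exist _ (F k) (mem_set (Ac _ (AF k)))); split; first exact: AF.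
apply: QB => /=; apply: EQ; rewrite /xsection /= inE; apply: VE.
have [N [mN N0 sN]] := filterI (ae_Phi_class cS) (ae_Phi_class (Ac _ (AF k))).
rewrite /L0_close /=; apply: le_lt_trans hk.
have -> : mu (bad k) = mu (bad k `|` N).
  by rewrite measureU0.
rewrite -(measurable_mu_extE mu) //; last exact: measurableU.
apply: le_outer_measure => x nV; have [Nx|nN] := pselect (N x); [by right|left].
have [eS eF] : (Phi T S x : symZN) = phi S x :> (int -> int) /\
    (Phi T (F k) x : symZN) = phi (F k) x :> (int -> int).
  by apply: contrapT => h; apply: nN; exact: sN.
apply: contrapT => nb; apply: nV; apply: PV => M PM /=.
have [a Ma] := CommNP (PC _ PM); rewrite /= eS eF.
by apply: contrapT => h; apply: nb; exists a; rewrite -Ma; split => // /esym.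
Qed.

Definition ae_limits (A : set (Aut mu)) : set (Aut mu) :=
  [set S | com S /\ exists F, (forall k, A (F k)) /\ ae_tends T F S].

(** For M' the image of M under Phi U^-1 x, eventually Phi (K k) x maps M' to M, so
    that its inverse maps M to M'; then Phi (F k) x and Phi S x eventually agree at M'. *)
Lemma ae_limits_closed A : group_closed (mem A) -> A `<=` com ->
  group_closed (mem (ae_limits A)).
Proof.
move=> /group_closedP[A1 AV] Ac; apply/group_closedP; split.
  split; first exact: com_full_group1.
  by exists (fun=> 1%g); split => //; apply: filterE => x M _; exists 0%N.
move=> S U [cS [F [AF FS]]] [cU [K [AK KU]]].
have cV := com_full_groupV hX hmu hT cU.
split; first exact: com_full_groupM.
exists (fun k => F k * (K k)^-1)%g; split; first by move=> k; exact: AV.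
have fK k : full_group T (K k) := (Ac _ (AK k)).1.
have fF k : full_group T (F k) := (Ac _ (AF k)).1.
have PFK : \forall x \ae mu, forall k, phi (F k * (K k)^-1)%g x = phi (F k) x \o phi (K k)^-1%g x.
  by apply: ae_all => k; apply: ae_PhiM => //; exact: full_groupV.
have PKK : \forall x \ae mu, forall k, cancel (phi (K k) x) (phi (K k)^-1%g x).
  by apply: ae_all => k; apply: filterS (ae_PhiV hX hmu hT (fK k)) => x [].
apply: filterS3 (filterI FS KU) (filterI PFK PKK)
  (filterI (ae_PhiM hX hmu hT cS.1 cV.1) (filterI (ae_PhiV hX hmu hT cU.1) cV.2)).
move=> x [tF tK] [eF eK] [-> [[_ VK] sV]] M cM.
have cM' := CommN_image sV cM; set M' := phi U^-1%g x @` M in cM'.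
have UM' : phi U x @` M' = M.
  rewrite /M' image_comp -[RHS]image_id; apply: eq_imagel => n _ /=.
  exact: VK.
have [k1 h1] := tF M' cM'; have [k2 h2] := tK M' cM'.
exists (maxn k1 k2) => k; rewrite geq_max => /andP[kk1 kk2].
have [E1 E2] := (h1 k kk1, h2 k kk2).
rewrite eF -[RHS]image_comp -/M' -E1 -[LHS]image_comp; congr (_ @` _).
rewrite -[in LHS]UM' -E2 image_comp -[RHS]image_id; apply: eq_imagel => n _ /=.
exact: eK.
Qed.

Lemma involution_periodic S : involution S -> ae_periodic S.
Proof.
move=> iS; have := ae_AutM S S; rewrite iS.
apply: filterS2 (ae_Aut1 mu) => x -> /esym SS.
apply: (@sub_finite_set _ _ [set x; S x]); last exact: finite_set2.
have Sinv : nsinv S x = S x by rewrite -{1}SS nsfunK.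
move=> _ [[k|k] _ <-] /=.
  by elim: k => [|k IH] /=; [left|case: IH => ->; rewrite ?SS; [right|left]].
elim: k => [|k IH] /=; first by right.
by case: IH => /= ->; rewrite ?Sinv ?nsfunK; [right|left].
Qed.

Lemma periodic_finite_cycles S : full_group T S -> ae_periodic S ->
  \forall x \ae mu, finite_cycles (phi S x).
Proof.
move=> fS perS; apply: filterS3 (ae_orbit T perS) (ae_Phi hX hmu hT fS)
  (ae_aperiodic hX hmu hT) => x per hS ap n.
have [p p0 pn] : exists2 p, (0 < p)%N & iter p S (iterz t n x) = iterz t n x.
  apply: finite_orbit_cycle; first exact: can_inj (nsfunK S).
  by apply: sub_finite_set (per n) => y [k _ <-]; exists (Posz k).
have it q : iter q S (iterz t n x) = iterz t (iter q (phi S x) n) x.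
  by elim: q => //= q ->; apply/hS.
by exists p => //; apply: (iterz_inj ap); rewrite /= -it.
Qed.

End index_kernel.

Theorem theorem2 (R : realType) (d : measure_display) (X : measurableType d)
    (mu : probability X R) (T : Aut mu)
    (hX : standard_borel R X) (hmu : atomless mu) (hT : ergodic T) :
  let com := com_full_group T in
  let gen_per := subgroup_generated [set S | com S /\ ae_periodic S] in
  let gen_inv := subgroup_generated [set S | com S /\ involution S] in
  let cl_der := com_closure T (derived_subgroup com) in
  let ker_index := [set S | com S /\ com_index T S = 0] in
  [/\ gen_per = gen_inv, gen_inv = cl_der, cl_der = ker_index &
      normal_subgroup ker_index com].
Proof.
move=> com gen_per gen_inv cl_der ker_index.
have inv_gen S : com S -> involution S -> gen_inv S.
  by move=> cS iS; apply: sub_subgroup_generated.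
have der_ker : derived_subgroup com `<=` ker_index by exact: derived_sub_ker_index.
have cycles_gen S : com S -> (\forall x \ae mu, finite_cycles (Phi_fun T S x)) -> gen_inv S.
  move=> cS /(finite_cycles_involutions hX hmu hT cS)[U [V [cU cV iU iV ->]]].
  by apply: subgroup_generatedM; exact: inv_gen.
have per_inv : gen_per `<=` gen_inv.
  apply: subgroup_generated_min; first exact: subgroup_generated_closed.
  by move=> S [cS pS]; apply: cycles_gen => //; apply: periodic_finite_cycles pS => //; exact: cS.1.
have inv_per : gen_inv `<=` gen_per.
  apply: subgroup_generated_min; first exact: subgroup_generated_closed.
  move=> S [cS iS]; apply: sub_subgroup_generated; split => //.
  exact: involution_periodic.
have inv_der : gen_inv `<=` cl_der.
  have der_com : derived_subgroup com `<=` com by move=> S /der_ker[].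
  have sub : gen_inv `<=` ae_limits T (derived_subgroup com).
    apply: subgroup_generated_min.
      by apply: ae_limits_closed => //; exact: subgroup_generated_closed.
    by move=> U [cU iU]; split => //; exact: involution_limit.
  by move=> S /sub[cS [F [DF FS]]]; exact: (ae_tends_closure DF).
have clo_ker : cl_der `<=` ker_index by exact: closure_sub_ker_index.
have ker_inv : ker_index `<=` gen_inv.
  move=> S [cS iS].
  have [P [cP iP perPS]] := index0_finite_cycles hX hmu hT cS iS.
  have -> : S = (P * (P * S))%g by rewrite mulgA iP mul1g.
  apply: subgroup_generatedM; first exact: inv_gen.
  by apply: cycles_gen => //; exact: com_full_groupM.
split; last exact: ker_index_normal.
- by apply/seteqP; split.
- by apply/seteqP; split => // S /clo_ker/ker_inv.
- by apply/seteqP; split => // S /ker_inv/inv_der.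
Qed.
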